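(* Let $S=(S,\le)$ be a partially ordered Polish space in which a subset is compact if and only if it is closed and order bounded. Let $P$ be an increasing stochastic kernel on $S$. If $P$ is order reversing, then $P$ is globally stable if and only if $P$ is bounded in probability.
   Context: A partially ordered Polish space is a separable, completely metrizable topological space $S$ with a closed partial order $\le$ (that is, $x_i\le y_i$, $x_i\to x$, $y_i\to y$ imply $x\le y$). A subset is order bounded if it is contained in some order interval $[a,b]=\{x:a\le x\le b\}$ with $a\le b$. $\mathcal B$ is the Borel $\sigma$-algebra, $\mathcal P(S)$ the set of Borel probability measures, $ibS$ the set of bounded Borel measurable increasing functions on $S$, $\phi(h)=\int h\,d\phi$; $\phi\preceq_{\mathrm{sd}}\psi$ means $\phi(h)\le\psi(h)$ for all $h\in ibS$; $\beta(\phi,\psi)=\sup\{|\phi(h)-\psi(h)|:h\in ibS,\ |h|\le1\}$. A stochastic kernel $P$ on $S$ is a map $P:S\times\mathcal B\to[0,1]$ with $P(x,\cdot)\in\mathcal P(S)$ for each $x$ and $x\mapsto P(x,B)$ measurable for each $B$; $(\phi P)(B)=\int P(x,B)\phi(dx)$; $P^t$ is the $t$-step kernel. $P$ is increasing if $x\le x'$ implies $P(x,\cdot)\preceq_{\mathrm{sd}}P(x',\cdot)$. A process $(X_t)_{t\in\mathbb Z_+}$ is $P$-Markov if $\mathbb P\{X_{t+1}\in B\mid\mathcal F_t\}=P(X_t,B)$ for all $t$ and $B$, with $(\mathcal F_t)$ its natural filtration. $P$ is order reversing if there exist two independent $P$-Markov processes $(X_t)$ and $(X'_t)$ on a common probability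 space such that, for every $x,x'\in S$ with $x'\le x$, there is a $t\in\mathbb Z_+$ with $\mathbb P_{x,x'}\{X_t\le X'_t\}>0$, where $\mathbb P_{x,x'}$ is probability conditional on $X_0=x$, $X'_0=x'$; equivalently, $(P^t(x,\cdot)\otimes P^t(x',\cdot))\{(y,y'):y\le y'\}>0$. $P$ is bounded in probability if the family $\{P^t(x,\cdot):t\in\mathbb Z_+\}$ is tight for every $x\in S$ (for all $\epsilon>0$ there is a compact $K\subset S$ with $P^t(x,K^c)\le\epsilon$ for all $t$). $P$ is globally stable if there is a unique $\phi^*\in\mathcal P(S)$ with $\phi^*P=\phi^*$ and $\beta(\phi P^t,\phi^* )\to0$ as $t\to\infty$ for all $\phi\in\mathcal P(S)$. *)

(* Defs.v *)
From HB Require Import structures.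
From mathcomp Require Import all_boot all_order all_algebra.
From mathcomp Require Import all_classical all_reals all_analysis.
From mathcomp Require Import measurable_realfun giry.

Set Implicit Arguments.
Unset Strict Implicit.
Unset Printing Implicit Defensive.

Import Order.TTheory GRing.Theory Num.Theory.
Import numFieldNormedType.Exports.

Local Open Scope classical_set_scope.
Local Open Scope ring_scope.

(* Library measurable types are pointed, hence so are the spaces considered
   here: the empty space has no probability measure. *)

Definition completely_metrizable (R : realType) (S : topologicalType) :=
  exists dist : S -> S -> R,
    [/\ forall x y, dist x y = 0 <-> x = y,
        forall x y, dist x y = dist y x,
        forall x y z, dist x z <= dist x y + dist y z,
        forall (x : S) (A : set S),
          nbhs x A <-> exists2 e : R, 0 < e & [set y | dist x y < e] `<=` A &
        forall u : nat -> S,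
          (forall e : R, 0 < e -> exists N : nat, forall m n : nat,
             (N <= m)%N -> (N <= n)%N -> dist (u m) (u n) < e) ->
          exists l : S, u @ \oo --> l].

Definition separable (S : topologicalType) :=
  exists2 D : set S, countable D & dense D.

Definition po_polish (R : realType) (d : Order.disp_t)
    (S : POrderedPointedTopological.type d) :=
  [/\ separable S, completely_metrizable R S &
      forall (u v : nat -> S) (x y : S), (forall i, (u i <= v i)%O) ->
        u @ \oo --> x -> v @ \oo --> y -> (x <= y)%O].

Definition order_bounded (d : Order.disp_t)
    (S : POrderedPointedTopological.type d) (A : set S) :=
  exists a b : S, (a <= b)%O /\ A `<=` [set x | (a <= x <= b)%O].

Notation borel S := (g_sigma_algebraType (@open S)).

Section kernels.
Local Open Scope ereal_scope.
Context d0 d1 d2 (T0 : measurableType d0) (T1 : measurableType d1)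
  (T2 : measurableType d2) (R : realType).

Section comp.
Context (k1 : R.-pker T0 ~> T1) (k2 : R.-pker T1 ~> T2).

Let mkcomp_noparam_prob x : mkcomp_noparam k1 k2 x [set: T2] = 1.
Proof.
rewrite /mkcomp_noparam /= /kcomp_noparam.
under eq_integral do rewrite prob_kernel.
by rewrite integral_cst// mul1e prob_kernel.
Qed.

HB.instance Definition _ := isProbabilityKernel.Build _ _ _ _ _
  (mkcomp_noparam k1 k2) mkcomp_noparam_prob.

End comp.

Section act.
Context (phi : probability T0 R) (k : R.-pker T0 ~> T1).

Definition kernel_act (B : set T1) : \bar R := \int[phi]_x k x B.

Let kernel_act0 : kernel_act set0 = 0.
Proof. by apply: integral0_eq => y _; rewrite measure0. Qed.

Let kernel_act_ge0 B : 0 <= kernel_act B.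
Proof. by apply: integral_ge0 => y _; exact: measure_ge0. Qed.

Let kernel_act_sigma_additive : semi_sigma_additive kernel_act.
Proof.
move=> U mU tU mUU; rewrite [X in _ --> X](_ : _ =
  \int[phi]_x (\sum_(0 <= n <oo) k x (U n))); last first.
  apply: eq_integral => y _.
  by apply/esym/cvg_lim => //; exact: measure_semi_sigma_additive.
apply/cvg_closeP; split.
  by apply: is_cvg_nneseries => n _ _; exact: integral_ge0.
rewrite closeE// integral_nneseries// => n.
exact: measurable_kernel.
Qed.

HB.instance Definition _ := isMeasure.Build _ _ _ kernel_act
  kernel_act0 kernel_act_ge0 kernel_act_sigma_additive.

Let kernel_act_setT : kernel_act [set: T1] = 1.
Proof.
rewrite /kernel_act.
under eq_integral do rewrite prob_kernel.
rewrite integral_cst// mul1e; exact: probability_setT.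
Qed.

HB.instance Definition _ := Measure_isProbability.Build _ _ _ kernel_act
  kernel_act_setT.

End act.
End kernels.

Fixpoint kernel_pow (R : realType) (d : measure_display) (T : measurableType d)
    (P : R.-pker T ~> T) (t : nat) : R.-pker T ~> T :=
  if t is t'.+1 then mkcomp_noparam P (kernel_pow P t')
  else kdirac (@measurable_id _ T setT).

Section order.
Context (R : realType) (d : Order.disp_t)
  (S : POrderedPointedTopological.type d).
Implicit Types (phi psi : {measure set (borel S) -> \bar R})
  (P : R.-pker borel S ~> borel S).

Definition ibS (h : borel S -> R) :=
  [/\ measurable_fun [set: borel S] h,
      exists M : R, forall x, `|h x| <= M &
      forall x y : S, (x <= y)%O -> h x <= h y].

Definition sd_le phi psi :=
  forall h : borel S -> R, ibS h -> \int[phi]_x h x <= \int[psi]_x h x.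

Definition beta phi psi : R :=
  sup [set `|\int[phi]_x h x - \int[psi]_x h x|
      | h in [set h : borel S -> R | ibS h /\ forall x, `|h x| <= 1]].

Definition increasing_kernel P :=
  forall x y : S, (x <= y)%O -> sd_le (P x) (P y).

Definition bounded_in_probability P :=
  forall x : S, forall e : R, 0 < e ->
    exists K : set S, compact K /\
      forall t : nat, (kernel_pow P t x (~` K) <= e%:E)%E.

(* Equality in P(S) is measure_eq, that is, equality on Borel sets: a library
   measure is a function on all subsets, arbitrary outside the sigma-algebra. *)
Definition globally_stable P :=
  let stable (phi : probability (borel S) R) :=
    kernel_act phi P ≡μ phi /\
    forall psi : probability (borel S) R,
      beta (kernel_act psi (kernel_pow P t)) phi @[t --> \oo] --> (0 : R) in
  exists phi : probability (borel S) R, stable phi /\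
    forall phi' : probability (borel S) R, stable phi' -> phi' ≡μ phi.

End order.

Section processes.
Context (R : realType) (dO dT : measure_display) (Om : measurableType dO)
  (T : measurableType dT).
Implicit Types (Pr : probability Om R) (X : nat -> Om -> T).

(* the sigma-algebra on Om generated by the X s with s in I *)
Definition sigma_process X (I : set nat) : set (set Om) :=
  <<s \bigcup_(s in I) preimage_set_system [set: Om] (X s) measurable >>.

Definition natural_filtration X (t : nat) := sigma_process X [set s | (s <= t)%N].

(* P(X t, B) is measurable for the natural filtration at t, so it is a version
   of the conditional probability of {X t.+1 \in B} as soon as it has the right
   integral over every event of the filtration. *)
Definition markov_process (P : R.-pker T ~> T) Pr X :=
  (forall t, measurable_fun [set: Om] (X t)) /\
  forall (t : nat) (A : set Om) (B : set T),
    natural_filtration X t A -> measurable B ->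
    (Pr (A `&` X t.+1 @^-1` B) = \int[Pr]_(w in A) P (X t w) B)%E.

Definition independent_processes Pr X X' :=
  forall A A' : set Om, sigma_process X setT A -> sigma_process X' setT A' ->
    (Pr (A `&` A') = Pr A * Pr A')%E.

Definition independent_markov P Pr X X' :=
  [/\ markov_process P Pr X, markov_process P Pr X' &
      independent_processes Pr X X'].

End processes.

(* Q z is a version of the probability Pr conditional on Z = z. *)
Definition regular_conditional (R : realType) (dO dT : measure_display)
    (Om : measurableType dO) (T : measurableType dT) (Pr : probability Om R)
    (Z : Om -> T) (Q : T -> probability Om R) :=
  forall A : set Om, measurable A ->
    measurable_fun [set: T] (Q ^~ A) /\
    forall C : set T, measurable C ->
      (Pr (A `&` Z @^-1` C) = \int[Pr]_(w in Z @^-1` C) Q (Z w) A)%E.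

(* Conditioning on (X 0, X' 0) = (x, x') determines Q (x, x') only up to a null
   set of pairs, whereas the condition concerns every pair; Q is therefore
   required to be the version under which, for every pair (x, x'), the two
   processes are independent, P-Markov and started at x and x'. *)
Definition order_reversing (R : realType) (d : Order.disp_t)
    (S : POrderedPointedTopological.type d) (P : R.-pker borel S ~> borel S) :=
  exists (dO : measure_display) (Om : measurableType dO)
    (Pr : probability Om R) (X X' : nat -> Om -> borel S)
    (Q : borel S * borel S -> probability Om R),
    [/\ independent_markov P Pr X X',
        regular_conditional Pr (fun w => (X 0%N w, X' 0%N w)) Q,
        forall x x' : S,
          [/\ independent_markov P (Q (x, x')) X X',
              Q (x, x') (X 0%N @^-1` [set x]) = 1%E &
              Q (x, x') (X' 0%N @^-1` [set x']) = 1%E] &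
        forall x x' : S, (x' <= x)%O ->
          exists t : nat,
            (0 < Q (x, x') [set w | ((X t w : S) <= (X' t w : S))%O])%E].

(* Main.v *)
Require Import Defs.
From HB Require Import structures.
From mathcomp Require Import all_boot all_order all_algebra.
From mathcomp Require Import finmap.
From mathcomp Require Import all_classical all_reals all_analysis.
From mathcomp Require Import measurable_realfun giry lra.

Set Implicit Arguments.
Unset Strict Implicit.
Unset Printing Implicit Defensive.

Import Order.TTheory GRing.Theory Num.Theory.
Import numFieldNormedType.Exports.

Local Open Scope classical_set_scope.
Local Open Scope ring_scope.

(** The theorem rests on a coupling bound.  Let two independent chains start at
    x and x', and let [not_crossed t (x, x')] be the probability that
    X_s <= X'_s fails at every time s <= t.  As soon as the chains are ordered,
    monotonicity of P keeps their later laws ordered, so every increasing h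
    with values in [0, 1] satisfies
    P^t h (x) <= P^t h (x') + [not_crossed t (x, x')] ([coupling]).
    The error term is the same for all h, which is what the distance beta
    asks for.

    The error tends to 0 when P is order reversing and bounded in probability
    ([not_crossed_cvg0]).  The probability of being unordered after s steps
    increases with x and decreases with x'; over the box [a, b] x [a, b] it is
    therefore largest at (b, a), and order reversing makes it smaller than 1
    at that pair for some s.  Tightness, together with the fact that compact
    sets are order bounded, puts both chains in one such box most of the time,
    so the error contracts geometrically up to the mass outside the box
    ([not_crossed_contraction]).

    No Feller property is available, so an invariant law cannot be obtained
    from weak limits alone.  Instead, the coupling bound shows that the laws
    P^n (x0, .) are Cauchy uniformly over increasing Borel sets
    ([kernel_pow_cauchy]), and a tight sequence with this property has a limit
    ([exists_incr_limit]).  Indeed the limit exists on the semiring of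
    intersections of an increasing and a decreasing Borel set.  It is
    countably additive there: an increasing set is approximated from inside,
    for one law of the sequence, by the upward closure of a compact set; this
    closure is again increasing and is also closed, so the approximation
    survives along the sequence, and compactness of order intervals reduces
    countable covers to finite ones.  Caratheodory's extension then yields a
    Borel probability because, inside an order interval, the semiring
    generates the Borel sets ([borel_trace]); for the same reason a Borel
    probability is determined by its values on increasing sets
    ([incr_determines]).  The limit is invariant since P maps increasing
    functions to increasing functions, and integrating the coupling bound
    against it shows that it attracts every initial law ([beta_cvg0]).

    Conversely, an invariant law is tight by Ulam's theorem, so it gives almost
    all of its mass to an order interval [a, b].  Beta-convergence carries this
    over to P^t (x, .) for large t, since the complement of [a, b] is covered
    by a decreasing set and an increasing one ([globally_stable_bounded]). *)

(** * Complete separable metrics *)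

(** The conditions on the witness of [completely_metrizable], named so that one
    metric can be fixed throughout. *)
Definition complete_metric (R : realType) (S : topologicalType)
    (dist : S -> S -> R) :=
  [/\ forall x y, dist x y = 0 <-> x = y,
      forall x y, dist x y = dist y x,
      forall x y z, dist x z <= dist x y + dist y z,
      forall (x : S) (A : set S),
        nbhs x A <-> exists2 e : R, 0 < e & [set y | dist x y < e] `<=` A &
      forall u : nat -> S,
        (forall e : R, 0 < e -> exists N : nat, forall m n : nat,
           (N <= m)%N -> (N <= n)%N -> dist (u m) (u n) < e) ->
        exists l : S, u @ \oo --> l].

Lemma filter_bigcapII (T : Type) (F : set_system T) (n : nat)
    (A : nat -> set T) : Filter F ->
  (forall i, (i < n)%N -> F (A i)) -> F (\bigcap_(i in `I_n) A i).
Proof.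
move=> FF; elim: n => [|n IH] FA.
  by apply: filterS filterT => x _ i.
have Fn : F (\bigcap_(i in `I_n) A i) by apply: IH => i /ltnW; exact: FA.
apply: filterS (filterI Fn (FA n (ltnSn n))) => x [xn xAn] i /=.
by rewrite ltnS leq_eqVlt => /orP[/eqP->//|/xn].
Qed.

Section metric.
Context (R : realType) (S : topologicalType) (dist : S -> S -> R).
Hypothesis hd : complete_metric dist.

Lemma dist_refl x : dist x x = 0.
Proof. by case: hd => h _ _ _ _; apply/h. Qed.

Lemma dist_sym x y : dist x y = dist y x.
Proof. by case: hd => _ h _ _ _; exact: h. Qed.

Lemma dist_triangle x y z : dist x z <= dist x y + dist y z.
Proof. by case: hd => _ _ h _ _; exact: h. Qed.

Lemma nbhs_dist x A :
  nbhs x A <-> exists2 e : R, 0 < e & [set y | dist x y < e] `<=` A.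
Proof. by case: hd. Qed.

Lemma nbhs_ball_dist x e : 0 < e -> nbhs x [set y | dist x y < e].
Proof. by move=> e0; apply/nbhs_dist; exists e. Qed.

Lemma open_ball_dist x e : open [set y | dist x y < e].
Proof.
rewrite openE => y /= xy; apply/nbhs_dist; exists (e - dist x y).
  by rewrite subr_gt0.
by move=> z /= yz; have := dist_triangle x y z; lra.
Qed.

Lemma closed_ball_dist x e : closed [set y | dist x y <= e].
Proof.
rewrite -openC openE => y /= /negP; rewrite -ltNge => xy.
apply/nbhs_dist; exists (dist x y - e); first by rewrite subr_gt0.
move=> z /= yz; apply/negP; rewrite -ltNge.
have := dist_triangle x z y; rewrite (dist_sym z y); lra.
Qed.

Lemma closed_bigcap_open (C : set S) : closed C ->
  C = \bigcap_n \bigcup_(c in C) [set y | dist c y < n.+1%:R^-1].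
Proof.
move=> cC; apply/seteqP; split => [x Cx n _|x Cx].
  by exists x => //=; rewrite dist_refl invr_gt0.
apply: cC => B /nbhs_dist [e e0 eB].
have [n] := ltr_add_invr (y := 0) (x := e) e0; rewrite add0r => ne.
have [c Cc cx] := Cx n I; exists c; split => //; apply: eB => /=.
by rewrite dist_sym (lt_trans cx).
Qed.

(** The point lies in the open ball while the closed ball lies in A: covers are
    made of open balls, and semiring sets are built from closed ones. *)
Lemma countable_base_dist : separable S -> (exists x : S, True) ->
  exists c : nat -> S, forall x A, nbhs x A -> exists i n : nat,
    dist (c i) x < n.+1%:R^-1 /\ [set y | dist (c i) y <= n.+1%:R^-1] `<=` A.
Proof.
move=> [D cD dD] [x0 _].
have [y Dy] : D !=set0.
  have [y [_ Dy]] := dD setT (ex_intro _ x0 I) openT; by exists y.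
have [c Dc] : exists c : nat -> S, D `<=` range c.
  move/countable_injP : cD => [f finj].
  exists (fun n => xget y [set z | D z /\ f z = n]) => z Dz.
  exists (f z) => //; case: xgetP => [w _ [Dw fwz]|/(_ z)]; last by case.
  by apply: finj; rewrite ?inE.
exists c => x A /nbhs_dist[e e0 eA].
have e20 : 0 < e / 2 by rewrite divr_gt0.
have [n] := ltr_add_invr (y := 0) (x := e / 2) e20; rewrite add0r => ne.
have n0 : 0 < n.+1%:R^-1 :> R by rewrite invr_gt0.
have [z [/= xz /Dc [i _ iz]]] := dD _
  (ex_intro _ x (nbhs_singleton (nbhs_ball_dist x n0)))
  (open_ball_dist x n.+1%:R^-1).
exists i, n; split; first by rewrite iz dist_sym.
move=> w /=; rewrite iz => zw; apply: eA => /=.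
have := dist_triangle x z w; move: ne xz zw => /=.
set r := _^-1; lra.
Qed.

(** An ultrafilter containing the intersection picks one ball of each radius, so
    it is Cauchy.  Completeness speaks of sequences only; the one used here
    takes its n-th point in the first n+1 of these balls. *)
Lemma compact_totally_bounded (c : nat -> S) (m : nat -> nat) :
  compact (\bigcap_n \bigcup_(i in `I_(m n))
    [set y | dist (c i) y <= n.+1%:R^-1]).
Proof.
set K := \bigcap_n _; rewrite compact_ultra => F FU FK.
have FP : ProperFilter F by exact: ultra_proper.
have cK : closed K.
  apply: closed_bigI => n _; apply: closed_bigcup; first exact: finite_II.
  by move=> i _; exact: closed_ball_dist.
have FB0 n : exists i, F [set y | dist (c i) y <= n.+1%:R^-1].
  apply: contrapT => /forallNP Fn.
  suff : F (~` K) by move=> FnK; have [x []] := filter_ex (filterI FK FnK).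
  have : F (\bigcap_(i in `I_(m n)) ~` [set y | dist (c i) y <= n.+1%:R^-1]).
    apply: filter_bigcapII => // i _.
    by have [/Fn|//] := in_ultra_setVsetC [set y | dist (c i) y <= n.+1%:R^-1] FU.
  apply: filterS => x Bx Kx; have [i im] := Kx n I.
  exact: Bx.
have [k FBn] := choice FB0.
pose B n := [set y | dist (c (k n)) y <= n.+1%:R^-1].
pose G n := K `&` \bigcap_(i in `I_n.+1) B i.
have FG n : F (G n).
  by apply: filterI => //; apply: filter_bigcapII => i _; exact: FBn.
have /choice[u uG] : forall n, exists x, G n x.
  by move=> n; exact: filter_ex (FG n).
have uB i n : (i <= n)%N -> B i (u n).
  by move=> ni; have [_] := uG n; apply.
have [l ul] : exists l : S, u @ \oo --> l.
  case: hd => _ _ _ _; apply => e e0.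
  have e20 : 0 < e / 2 by rewrite divr_gt0.
  have [N] := ltr_add_invr (y := 0) (x := e / 2) e20; rewrite add0r => ne.
  exists N => p q Np Nq; have := uB _ _ Np; have := uB _ _ Nq.
  rewrite /B/=; move: (c _) => a aq ap.
  have := dist_triangle (u p) a (u q); rewrite (dist_sym _ a).
  by move: ne aq ap; set r := _^-1; lra.
exists l; split.
  apply: (closed_cvg K cK _ l ul); apply: nearW => n.
  by have [] := uG n.
move=> A /= /nbhs_dist[e e0 eA].
have e30 : 0 < e / 3 by rewrite divr_gt0.
have [N] := ltr_add_invr (y := 0) (x := e / 3) e30; rewrite add0r => ne.
have /ul [M _ Ml] := nbhs_ball_dist l e30.
have := Ml (maxn M N) (leq_maxl _ _); have := uB N (maxn M N) (leq_maxr _ _).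
move=> /= Bu lu; apply: filterS (FBn N) => y; rewrite /B/= in Bu *.
move: Bu lu ne; move: (c _) (u _) => a b ab lb ne ay; apply: eA => /=.
have := dist_triangle l b y; have := dist_triangle b a y.
rewrite (dist_sym b a); move: ne ab lb ay; set r := _^-1; lra.
Qed.

End metric.

(** * Regularity of finite Borel measures *)

Section finite_measure_approximation.
Local Open Scope ereal_scope.
Context (R : realType) (d : measure_display) (T : measurableType d)
  (mu : {measure set T -> \bar R}).
Hypothesis muT : mu setT < +oo.

Lemma measure_lt_pinfty A : measurable A -> mu A < +oo.
Proof.
by move=> mA; apply: le_lt_trans muT; apply: le_measure; rewrite ?inE.
Qed.

(** Continuity from above, applied to the differences, which decrease to the
    empty set. *)
Lemma nondecreasing_exhaustion (F : nat -> set T) (B : set T) (e : R) :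
  (forall n, measurable (F n)) -> nondecreasing_seq F -> measurable B ->
  B `<=` \bigcup_n F n -> (0 < e)%R -> exists m, mu (B `\` F m) <= e%:E.
Proof.
move=> mF ndF mB BF e0.
have mD n : measurable (B `\` F n) by exact: measurableD.
have D0 : \bigcap_n (B `\` F n) = set0.
  rewrite -subset0 => x Dx; have [Bx _] := Dx 0%N I.
  by have [n _ Fx] := BF _ Bx; have [_ /(_ Fx)] := Dx n I.
have := @nonincreasing_cvg_mu _ _ _ mu (fun n => B `\` F n)
  (measure_lt_pinfty (mD 0%N)) mD _ _.
rewrite D0 measure0 => /(_ measurable0) h.
have /h : {homo (fun n => B `\` F n) : n m / (n <= m)%N >-> (m <= n)%O}.
  by move=> n m nm; apply/subsetPset; apply: setDS; apply/subsetPset/ndF.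
move/fine_cvgP => -[[M _ fM] /cvgrPdist_lt/(_ _ e0)[N _ Ne]].
exists (maxn M N); have /= := Ne (maxn M N) (leq_maxr _ _).
have /= := fM (maxn M N) (leq_maxl _ _).
rewrite sub0r normrN => /fineK <-; rewrite lee_fin => /ltW.
exact: le_trans (ler_norm _).
Qed.

End finite_measure_approximation.

Section regularity.
Local Open Scope ereal_scope.
Context (R : realType) (S : ptopologicalType) (dist : S -> S -> R).
Hypothesis hd : complete_metric dist.
Hypothesis hS : separable S.
Context (mu : {measure set (borel S) -> \bar R}).
Hypothesis muT : mu setT < +oo.

Lemma open_borel (A : set S) : open A -> measurable (A : set (borel S)).
Proof. exact: sub_sigma_algebra. Qed.

Lemma closed_borel (A : set S) : closed A -> measurable (A : set (borel S)).
Proof.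
move=> cA; rewrite -[A]setCK; apply: measurableC; apply: open_borel.
exact: closed_openC.
Qed.

(** Ulam's theorem.  Finitely many balls of radius 1/(n+1) carry all the mass
    but e/2^(n+1); intersecting these finite unions over n leaves a closed
    totally bounded set. *)
Lemma ulam_tight (e : R) : (0 < e)%R ->
  exists K : set S, [/\ compact K, closed K & mu (~` K) <= e%:E].
Proof.
move=> e0.
have [c cb] := countable_base_dist hd hS (ex_intro _ point I).
pose B n i : set S := [set y | dist (c i) y <= n.+1%:R^-1]%R.
pose U n m := \bigcup_(i in `I_m) B n i.
have cU n m : closed (U n m).
  apply: closed_bigcup; first exact: finite_II.
  by move=> i _; exact: closed_ball_dist.
have hm n : exists m, mu (~` U n m) <= (e / (2 ^ n.+1)%:R)%:E.
  have e20 : (0 < e / (2 ^ n.+1)%:R)%R by rewrite divr_gt0.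
  have [] := @nondecreasing_exhaustion _ _ _ mu muT (U n) setT _ _ _ _ _ e20.
  - by move=> m; apply: closed_borel; exact: cU.
  - move=> p q pq; apply/subsetPset; apply: bigcup_subset => i /=.
    by move/leq_trans; apply.
  - exact: measurableT.
  - move=> x _.
    have [|i [j [_ iU]]] := cb x [set y | dist x y < n.+1%:R^-1]%R.
      by apply: nbhs_ball_dist => //; rewrite invr_gt0.
    exists i.+1 => //; exists i => //=; apply: ltW; rewrite (dist_sym hd).
    apply: iU => /=; rewrite (dist_refl hd) invr_ge0//.
  - by move=> m; rewrite setTD => ?; exists m.
have [m mP] := choice hm.
exists (\bigcap_n U n (m n)); split.
- exact: compact_totally_bounded.
- exact: closed_bigI.
- rewrite setC_bigcap.
  have mC n : measurable (~` U n (m n) : set (borel S)).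
    by apply: measurableC; apply: closed_borel; exact: cU.
  have := measure_sigma_subadditive mu mC
    (bigcupT_measurable _ mC) (@subset_refl _ _).
  move=> /le_trans; apply; apply: le_trans (epsilon_trick0 xpredT (ltW e0)).
  exact: lee_nneseries.
Qed.

Let inner_closed (B : set (borel S)) := forall e : R, (0 < e)%R ->
  exists C : set S, [/\ closed C, C `<=` B & mu (B `\` C) <= e%:E].

(** Finitely many of the closed pieces already exhaust the union up to e/2, and
    a finite union of closed sets is closed. *)
Let inner_closed_bigcup (B : nat -> set (borel S)) :
  (forall n, measurable (B n)) -> (forall n, inner_closed (B n)) ->
  inner_closed (\bigcup_n B n).
Proof.
move=> mB iB e e0; have e20 : (0 < e / 2)%R by rewrite divr_gt0.
have hC n : exists C : set S, [/\ closed C, C `<=` B n &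
    mu (B n `\` C) <= (e / 2 / (2 ^ n.+1)%:R)%:E].
  by apply: iB; rewrite divr_gt0.
have [C CP] := choice hC.
have mC n : measurable (C n : set (borel S)).
  by apply: closed_borel; have [] := CP n.
have [||||m hm] := @nondecreasing_exhaustion _ _ _ mu muT
    (fun m => \bigcup_(i in `I_m) C i) (\bigcup_n C n) _ _ _ _ _ e20.
- by move=> m; apply: bigcup_measurable.
- move=> p q pq; apply/subsetPset; apply: bigcup_subset => i /=.
  by move/leq_trans; apply.
- exact: bigcupT_measurable.
- by move=> x [n _ Cx]; exists n.+1 => //; exists n => /=.
exists (\bigcup_(i in `I_m) C i); split.
- apply: closed_bigcup; first exact: finite_II.
  by move=> i _; have [] := CP i.
- by move=> x [n _ Cx]; exists n => //; have [_ CB _] := CP n; exact: CB.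
- have -> : (e = e / 2 + e / 2)%R by lra.
  rewrite EFinD; apply: (@le_trans _ _ (mu (\bigcup_n (B n `\` C n)) +
    mu (\bigcup_n C n `\` \bigcup_(i in `I_m) C i))).
    apply: le_trans (measureU2 _ _ _); last 2 first.
    + by apply: bigcupT_measurable => n; exact: measurableD.
    + apply: measurableD; first exact: bigcupT_measurable.
      exact: bigcup_measurable.
    apply: le_measure; rewrite ?inE.
    + by apply: measurableD; [exact: bigcupT_measurable|exact: bigcup_measurable].
    + apply: measurableU.
        by apply: bigcupT_measurable => n; exact: measurableD.
      apply: measurableD; first exact: bigcupT_measurable.
      exact: bigcup_measurable.
    + move=> x [[n _ Bx] Cx]; have [Cnx|Cnx] := pselect (C n x).
        by right; split => //; exists n.
      by left; exists n.
  apply: leeD => //.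
  have mBC n : measurable (B n `\` C n) by exact: measurableD.
  have := measure_sigma_subadditive mu mBC
    (bigcupT_measurable _ mBC) (@subset_refl _ _).
  move=> /le_trans; apply; apply: le_trans (epsilon_trick0 xpredT (ltW e20)).
  by apply: lee_nneseries => // n _; have [] := CP n.
Qed.

(** The sets that are approximated from inside by closed sets and whose
    complements are too form a sigma-algebra.  It contains the open sets,
    because in a metric space an open set is a countable union of closed
    ones. *)
Let inner_closed_borel (B : set (borel S)) : measurable B -> inner_closed B.
Proof.
suff : <<s @open S >> `<=` [set B : set (borel S) |
    [/\ measurable B, inner_closed B & inner_closed (~` B)]].
  by move=> h mB; have [] := h _ mB.
have closedP (C : set S) : closed C -> inner_closed C.
  by move=> cC e e0; exists C; split => //; rewrite setDv measure0 lee_fin ltW.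
have openP (A : set S) : open A -> inner_closed A.
  move=> oA.
  have -> : A = \bigcup_n ~` \bigcup_(c in ~` A)
      [set y | dist c y < n.+1%:R^-1]%R.
    rewrite -setC_bigcap -[LHS]setCK; congr (~` _).
    by apply: (closed_bigcap_open hd); exact: open_closedC.
  apply: inner_closed_bigcup => n.
    apply: closed_borel; apply: open_closedC; apply: bigcup_open => c _.
    exact: open_ball_dist.
  apply: closedP; apply: open_closedC; apply: bigcup_open => c _.
  exact: open_ball_dist.
apply: smallest_sub; last first.
  move=> A oA; split; [exact: open_borel|exact: openP|].
  by apply: closedP; exact: open_closedC.
split => /=.
- split; [exact: measurable0|exact: closedP closed0|rewrite setC0].
  exact: closedP closedT.
- move=> A [mA iA iCA]; rewrite setTD; split => //; last by rewrite setCK.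
  exact: measurableC.
- move=> A hA; split.
  + by apply: bigcupT_measurable => n; have [] := hA n.
  + by apply: inner_closed_bigcup => n; have [] := hA n.
  + rewrite setC_bigcup => e e0.
    have hC n : exists C : set S, [/\ closed C, C `<=` ~` A n &
        mu (~` A n `\` C) <= (e / (2 ^ n.+1)%:R)%:E].
      by have [_ _] := hA n; apply; rewrite divr_gt0.
    have [C CP] := choice hC.
    have mAC n : measurable (~` A n `\` C n : set (borel S)).
      have [mA _ _] := hA n; have [cC _ _] := CP n.
      by apply: measurableD; [exact: measurableC|exact: closed_borel].
    exists (\bigcap_n C n); split.
    * by apply: closed_bigI => n _; have [] := CP n.
    * by move=> x Cx n _; have [_ CA _] := CP n; exact/CA/Cx.
    * apply: le_trans (epsilon_trick0 xpredT (ltW e0)).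
      apply: (@le_trans _ _ (\sum_(0 <= n <oo) mu (~` A n `\` C n))).
        apply: measure_sigma_subadditive => //.
          apply: measurableD.
            apply: bigcapT_measurable => n; apply: measurableC.
            by have [] := hA n.
          by apply: bigcapT_measurable => n; apply: closed_borel; have [] := CP n.
        move=> x [Ax /existsNP[n /not_implyP[_ Cx]]].
        by exists n => //; split => //; exact: Ax.
      by apply: lee_nneseries => // n _; have [] := CP n.
Qed.

Lemma inner_regular_compact (B : set (borel S)) (e : R) :
  measurable B -> (0 < e)%R ->
  exists K : set S, [/\ compact K, K `<=` B & mu (B `\` K) <= e%:E].
Proof.
move=> mB e0; have e20 : (0 < e / 2)%R by rewrite divr_gt0.
have [K [cptK clK mK]] := ulam_tight e20.
have [C [clC CB mC]] := inner_closed_borel mB e20.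
exists (C `&` K); split.
- by apply: subclosed_compact cptK _; [exact: closedI|exact: subIsetr].
- by move=> x [/CB].
- have -> : (e = e / 2 + e / 2)%R by lra.
  rewrite EFinD; apply: (@le_trans _ _ (mu (B `\` C) + mu (~` K))).
    have mBC : measurable (B `\` C).
      by apply: measurableD => //; exact: closed_borel.
    have mCK : measurable (~` K : set (borel S)).
      by apply: measurableC; exact: closed_borel.
    apply: le_trans (measureU2 _ mBC mCK).
    apply: le_measure; rewrite ?inE; first 2 last.
    + move=> x [Bx CKx]; have [Cx|Cx] := pselect (C x); last by left.
      by right => Kx; exact: CKx.
    + apply: measurableD => //; apply: closed_borel; exact: closedI.
    + exact: measurableU.
  exact: leeD.
Qed.

End regularity.

(** * Closed orders and increasing Borel sets *)

Section closed_relation.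
Context (S : topologicalType).
Implicit Types (r : S -> S -> Prop) (A K : set S).

(** Neighbourhoods rather than sequences, and an arbitrary relation rather than
    the order: each result on upsets then applies to downsets through the
    converse relation. *)
Definition closed_rel r := forall x y, ~ r x y ->
  \forall x' \near x & y' \near y, ~ r x' y'.

Definition upset r A := forall x y, r x y -> A x -> A y.

Definition upclosure r K : set S := [set y | exists2 x, K x & r x y].

(** Projecting a closed relation along a compact set keeps it closed: if no point
    of K is related to y, finitely many neighbourhoods of points of K exclude
    all points close to y. *)
Lemma closed_upclosure r K : closed_rel r -> compact K -> closed (upclosure r K).
Proof.
move=> cr /compact_near_coveringP cK; rewrite -openC openE => y nKy.
have := cK _ (nbhs y) (fun y' x => ~ r x y') (nbhs_filter y).
have cov x : K x -> \forall x' \near x & y' \near y, ~ r x' y'.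
  by move=> Kx; apply: cr => rxy; apply: nKy; exists x.
by move=> /(_ cov); apply: filterS => y' h [x Kx]; exact: h.
Qed.

Lemma upset_upclosure r K : (forall x y z, r x y -> r y z -> r x z) ->
  upset r (upclosure r K).
Proof. by move=> tr x y xy [z Kz zx]; exists z => //; exact: tr xy. Qed.

Lemma upclosure_sub r K A : upset r A -> K `<=` A -> upclosure r K `<=` A.
Proof. by move=> uA KA y [x /KA Ax xy]; exact: uA Ax. Qed.

Lemma sub_upclosure r K : (forall x, r x x) -> K `<=` upclosure r K.
Proof. by move=> rr x Kx; exists x. Qed.

Lemma closed_rel_flip r : closed_rel r -> closed_rel (fun x y => r y x).
Proof.
move=> cr x y /cr [[A B] [/= yA xB] AB]; exists (B, A) => // -[u v] [Bu Av].
by apply: (AB (v, u)).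
Qed.

End closed_relation.

Section ordered_space.
Context (d : Order.disp_t)
  (S : POrderedPointedTopological.type d).

Definition le_rel (x y : S) : Prop := (x <= y)%O.
Definition ge_rel (x y : S) : Prop := (y <= x)%O.
Definition order_itv (a b : S) : set S := [set x | (a <= x <= b)%O].

(** Otherwise points taken in balls of radius 1/(n+1) around x and y would form
    ordered sequences with unordered limits. *)
Lemma closed_le_rel (R : realType) (dist : S -> S -> R) : complete_metric dist ->
  (forall (u v : nat -> S) (x y : S), (forall i, (u i <= v i)%O) ->
     u @ \oo --> x -> v @ \oo --> y -> (x <= y)%O) -> closed_rel le_rel.
Proof.
move=> hd hle x y nxy; apply: contrapT => nnear.
have /choice[w wP] (n : nat) : exists w : S * S,
    [/\ dist x w.1 < n.+1%:R^-1, dist y w.2 < n.+1%:R^-1 & (w.1 <= w.2)%O].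
  apply: contrapT => /forallNP h; apply: nnear.
  have n0 : 0 < n.+1%:R^-1 :> R by rewrite invr_gt0.
  exists ([set z | dist x z < n.+1%:R^-1], [set z | dist y z < n.+1%:R^-1]).
    by split; exact: nbhs_ball_dist.
  by move=> z [xz yz] lez; apply: (h z).
have cvgw (f : nat -> S) z : (forall n, dist z (f n) < n.+1%:R^-1) ->
    f @ \oo --> z.
  move=> zf A /(nbhs_dist hd)[e e0 eA].
  have [N] := ltr_add_invr (y := 0) (x := e) e0; rewrite add0r => ne.
  exists N => // n /= Nn; apply: eA; apply: lt_trans (zf n) _.
  by apply: le_lt_trans ne; rewrite lef_pV2 ?posrE// ler_nat.
apply: nxy; apply: (hle (fun n => (w n).1) (fun n => (w n).2)).
- by move=> n; have [] := wP n.
- by apply: cvgw => n; have [] := wP n.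
- by apply: cvgw => n; have [] := wP n.
Qed.

Hypothesis hle : closed_rel le_rel.

Let hge : closed_rel ge_rel. Proof. exact: closed_rel_flip hle. Qed.

Lemma closed_order_itv a b : closed (order_itv a b).
Proof.
have -> : order_itv a b = upclosure le_rel [set a] `&` upclosure ge_rel [set b].
  apply/seteqP; split => x /=.
    by move=> /andP[ax xb]; split; [exists a|exists b].
  by move=> [[_ -> ax] [_ -> xb]]; apply/andP.
by apply: closedI; apply: closed_upclosure => //; exact: compact_set1.
Qed.

Hypothesis hcompact : forall A : set S, compact A <-> closed A /\ order_bounded A.

Lemma compact_order_itv a b : (a <= b)%O -> compact (order_itv a b).
Proof.
move=> ab; apply/hcompact; split; first exact: closed_order_itv.
by exists a, b; split.
Qed.

Lemma compact_sub_order_itv K : compact K ->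
  exists a b, (a <= b)%O /\ K `<=` order_itv a b.
Proof. by move=> /hcompact[]. Qed.

Definition incr (A : set (borel S)) := measurable A /\ upset le_rel A.
Definition decr (A : set (borel S)) := measurable A /\ upset ge_rel A.

Lemma incrC A : incr A -> decr (~` A).
Proof.
move=> [mA uA]; split; first exact: measurableC.
by move=> x y yx; apply: contra_not; exact: uA.
Qed.

Lemma decrC A : decr A -> incr (~` A).
Proof.
move=> [mA uA]; split; first exact: measurableC.
by move=> x y yx; apply: contra_not; exact: uA.
Qed.

Lemma incrI A B : incr A -> incr B -> incr (A `&` B).
Proof.
move=> [mA uA] [mB uB]; split; first exact: measurableI.
by move=> x y xy [/(uA _ _ xy) ? /(uB _ _ xy)].
Qed.

Lemma decrI A B : decr A -> decr B -> decr (A `&` B).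
Proof.
move=> [mA uA] [mB uB]; split; first exact: measurableI.
by move=> x y xy [/(uA _ _ xy) ? /(uB _ _ xy)].
Qed.

Lemma incrT : incr setT. Proof. by []. Qed.
Lemma incr_upclosure K : compact K -> incr (upclosure le_rel K).
Proof.
move=> cK; split; first by apply: closed_borel; exact: closed_upclosure.
by apply: upset_upclosure => x y z; exact: le_trans.
Qed.

Lemma decr_upclosure K : compact K -> decr (upclosure ge_rel K).
Proof.
move=> cK; split; first by apply: closed_borel; exact: closed_upclosure.
by apply: upset_upclosure => x y z yx zy; exact: le_trans yx.
Qed.

(** Increasing sets are not closed under complement.  Adding the decreasing ones
    and intersecting gives the smallest semiring that contains them, which is
    what the extension of a content requires. *)
Definition incr_decr : set (set (borel S)) :=
  [set A | exists I D, [/\ incr I, decr D & A = I `&` D]].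

Lemma incr_decr_incr A : incr A -> incr_decr A.
Proof. by move=> iA; exists A, setT; split; rewrite ?setIT. Qed.

Lemma incr_decr_decr A : decr A -> incr_decr A.
Proof. by move=> iA; exists setT, A; split; rewrite ?setTI. Qed.

Lemma incr_decr0 : incr_decr set0.
Proof. by apply: incr_decr_incr; split. Qed.

Lemma incr_decrI : setI_closed incr_decr.
Proof.
move=> _ _ [I [D [iI dD ->]]] [J [E [iJ dE ->]]].
by exists (I `&` J), (D `&` E); split; [exact: incrI|exact: decrI|rewrite setIACA].
Qed.

Lemma incr_decrD : semi_setD_closed incr_decr.
Proof.
move=> _ _ [I [D [iI dD ->]]] [J [E [iJ dE ->]]].
exists [set I `&` (D `&` ~` J); (I `&` J `&` ~` E) `&` D]; split.
- exact: finite_set2.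
- move=> _ [->|->].
    by exists I, (D `&` ~` J); split => //; apply: decrI => //; exact: incrC.
  exists (I `&` J `&` ~` E), D; split => //; apply: incrI; first exact: incrI.
  exact: decrC.
- rewrite bigcup_setU !bigcup_set1; apply/seteqP; split => x.
    move=> [[Ix Dx] nJE]; have [Jx|Jx] := pselect (J x); last by left.
    by right; split => //; split => // Ex; exact: nJE.
  move=> [[Ix [Dx nJ]]|[[[Ix Jx] nE] Dx]]; split => //; by move=> [].
- apply/trivIsetP => _ _ [->|->] [->|->]; rewrite ?eqxx// => _;
  by apply/seteqP; split => // x /= [[? ?] ?]; firstorder.
Qed.

Lemma incr_decr_measurable : incr_decr `<=` measurable.
Proof. by move=> _ [I [D [[mI _] [mD _] ->]]]; exact: measurableI. Qed.

Lemma incr_decr_order_itv a b : incr_decr (order_itv a b).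
Proof.
exists (upclosure le_rel [set a]), (upclosure ge_rel [set b]); split.
- by apply: incr_upclosure; exact: compact_set1.
- by apply: decr_upclosure; exact: compact_set1.
- apply/seteqP; split => x /=.
    by move=> /andP[ax xb]; split; [exists a|exists b].
  by move=> [[_ -> ax] [_ -> xb]]; apply/andP.
Qed.

Context (R : realType) (dist : S -> S -> R).
Hypothesis hd : complete_metric dist.
Hypothesis hS : separable S.

(** Let y be in the interval K but not in C.  Each x in C differs from y, hence
    x <= y or y <= x fails, and x then has a closed ball whose upward or
    downward closure misses y.  By compactness finitely many of these
    closures cover the trace of C on K, and their union still misses y.  So
    the trace is the intersection of K with the finite unions of closures
    that contain the trace, and there are countably many of these. *)
Let closed_trace (C : set S) a b : (a <= b)%O -> closed C ->
  <<s incr_decr >> (C `&` order_itv a b).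
Proof.
move=> ab cC; set K := order_itv a b.
have cK : compact K by exact: compact_order_itv.
have [c cb] := countable_base_dist hd hS (ex_intro _ point I).
pose J := (nat * nat * bool)%type.
pose B (t : J) := K `&` [set y | dist (c t.1.1) y <= t.1.2.+1%:R^-1].
have cB t : compact (B t) by apply: compact_closedI => //; exact: closed_ball_dist.
pose Z (t : J) := if t.2 then upclosure le_rel (B t) else upclosure ge_rel (B t).
have mZ t : <<s incr_decr >> (Z t).
  apply: sub_sigma_algebra; rewrite /Z; case: ifP => _.
    by apply: incr_decr_incr; exact: incr_upclosure.
  by apply: incr_decr_decr; exact: decr_upclosure.
have BZ t : B t `<=` Z t.
  by rewrite /Z; case: ifP => _; apply: sub_upclosure => x; rewrite /le_rel /ge_rel.
pose F (D : {fset J}) := \bigcup_(t in [set` D]) Z t.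
have mF D : <<s incr_decr >> (F D).
  apply: (@fin_bigcup_measurable _ (g_sigma_algebraType incr_decr)) => // t _.
  exact: mZ.
suff -> : C `&` K = K `&` \bigcap_(D in [set D | C `&` K `<=` F D]) F D.
  apply: (@measurableI _ (g_sigma_algebraType incr_decr)).
    by apply: sub_sigma_algebra; exact: incr_decr_order_itv.
  rewrite -[\bigcap_(D in _) _]setCK setC_bigcap.
  apply: (@measurableC _ (g_sigma_algebraType incr_decr)).
  rewrite bigcup_mkcond.
  apply: (@countable_bigcupT_measurable _ (g_sigma_algebraType incr_decr)) => [|D].
    exact: countableP.
  case: ifP => _; last exact: (@measurable0 _ (g_sigma_algebraType incr_decr)).
  by apply: (@measurableC _ (g_sigma_algebraType incr_decr)); exact: mF.
apply/seteqP; split => [y [Cy Ky]|y [Ky Fy]].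
  by split => // D; exact.
split => //; apply: contrapT => nCy.
have CK : compact (C `&` K).
  by rewrite setIC; exact: compact_closedI.
move: CK; rewrite compact_cover => /(_ J [set t | ~ Z t y]
  (fun t => [set z | dist (c t.1.1) z < t.1.2.+1%:R^-1])).
case=> [t _|x [Cx Kx]|D DZ CKD].
- exact: open_ball_dist.
- have nxy (r : S -> S -> Prop) : closed_rel r -> ~ r x y ->
      exists i n, dist (c i) x < n.+1%:R^-1 /\
        [set z | dist (c i) z <= n.+1%:R^-1] `<=` [set z | ~ r z y].
    move=> cr /cr[[U V] [/= xU yV] UV]; apply: cb.
    apply: filterS xU => z Uz; apply: (UV (z, y)); split => //=.
    exact: nbhs_singleton.
  have [xy|nxly] := boolP (x <= y)%O.
    have nyx : ~ ge_rel x y.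
      move=> yx; apply: nCy; suff -> : y = x by [].
      by apply/eqP; rewrite eq_le xy; move: yx; rewrite /ge_rel => ->.
    have [i [n [ix inr]]] := nxy _ hge nyx.
    by exists (i, n, false) => //=; rewrite /Z/= => -[z [_ /inr]].
  have [i [n [ix inr]]] := nxy _ hle (negP nxly).
  by exists (i, n, true) => //=; rewrite /Z/= => -[z [_ /inr]].
- have : F D y.
    apply: Fy => x CKx; have [t Dt xt] := CKD _ CKx; exists t => //.
    by apply: BZ; split; [case: CKx|exact: ltW].
  by move=> [t /DZ]; rewrite inE.
Qed.

Lemma borel_trace (A : set (borel S)) a b : (a <= b)%O -> measurable A ->
  <<s incr_decr >> (A `&` order_itv a b).
Proof.
move=> ab; move: A.
have mK : <<s incr_decr >> (order_itv a b).
  by apply: sub_sigma_algebra; exact: incr_decr_order_itv.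
have trC A : <<s incr_decr >> (A `&` order_itv a b) ->
    <<s incr_decr >> (~` A `&` order_itv a b).
  move=> mA; rewrite setIC -setDE.
  have -> : order_itv a b `\` A = order_itv a b `\` (A `&` order_itv a b).
    by rewrite setDIr setDv setU0.
  exact: (@measurableD _ (g_sigma_algebraType incr_decr)).
apply: smallest_sub => [|A oA /=].
  split => /=.
  - by rewrite set0I; exact: (@measurable0 _ (g_sigma_algebraType incr_decr)).
  - by move=> A mA; rewrite setTD; exact: trC.
  - move=> F mF; rewrite setI_bigcupl.
    exact: (@bigcupT_measurable _ (g_sigma_algebraType incr_decr)).
by rewrite -[A]setCK; apply: trC; apply: closed_trace => //; exact: open_closedC.
Qed.

Lemma borel_trace_bigcup (A : set (borel S)) (a b : nat -> S) :
  (forall n, (a n <= b n)%O) -> measurable A ->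
  <<s incr_decr >> (A `&` \bigcup_n order_itv (a n) (b n)).
Proof.
move=> ab mA; rewrite setI_bigcupr.
apply: (@bigcupT_measurable _ (g_sigma_algebraType incr_decr)) => n.
exact: borel_trace.
Qed.

End ordered_space.

(** * Increasing sets determine a measure *)

Lemma probability_of_measure (R : realType) d (T : measurableType d)
    (m : {measure set T -> \bar R}) :
  m setT = 1%E -> exists P : probability T R, forall A, P A = m A.
Proof.
(* the Dirac mass is the default value for a total mass of 0 or +oo *)
move=> mT; exists (mnormalize m (\d_(point : T))) => A /=.
by rewrite /mnormalize mT onee_eq0/= invr1 mule1.
Qed.

Section determination.
Local Open Scope ereal_scope.
Context (R : realType) (d : Order.disp_t)
  (S : POrderedPointedTopological.type d).
Hypothesis hle : closed_rel (@le_rel d S).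
Hypothesis hcompact : forall A : set S, compact A <-> closed A /\ order_bounded A.
Context (dist : S -> S -> R).
Hypothesis hd : complete_metric dist.
Hypothesis hS : separable S.
Implicit Types m : {measure set (borel S) -> \bar R}.

Lemma borel_order_itv (a b : S) : measurable (order_itv a b : set (borel S)).
Proof. by apply: closed_borel; exact: closed_order_itv. Qed.

Lemma setC_order_itv_le m K (e : \bar R) : closed K -> m (~` K) <= e ->
  forall a b, K `<=` order_itv a b -> m (~` order_itv a b) <= e.
Proof.
move=> clK Ke a b Kab; apply: le_trans Ke; apply: le_measure; rewrite ?inE.
- by apply: measurableC; exact: borel_order_itv.
- by apply: measurableC; exact: closed_borel.
- exact: subsetC.
Qed.

Lemma ulam_order_itv2 m1 m2 (e : R) : m1 setT < +oo -> m2 setT < +oo -> (0 < e)%R ->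
  exists a b, [/\ (a <= b)%O, m1 (~` order_itv a b) <= e%:E &
    m2 (~` order_itv a b) <= e%:E].
Proof.
move=> h1 h2 e0; have [K1 [cK1 clK1 mK1]] := ulam_tight hd hS h1 e0.
have [K2 [cK2 clK2 mK2]] := ulam_tight hd hS h2 e0.
have [a [b [ab Kab]]] := compact_sub_order_itv hcompact (compactU cK1 cK2).
exists a, b; split => //.
- by apply: (setC_order_itv_le clK1 mK1) => x K1x; apply: Kab; left.
- by apply: (setC_order_itv_le clK2 mK2) => x K2x; apply: Kab; right.
Qed.

Lemma bigcup_order_itv_null m (a b : nat -> S) :
  (forall n, m (~` order_itv (a n) (b n)) <= n.+1%:R^-1%:E) ->
  m (~` \bigcup_n order_itv (a n) (b n)) = 0.
Proof.
move=> h; apply/eqP; rewrite eq_le measure_ge0 andbT.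
have mU : measurable (~` \bigcup_n order_itv (a n) (b n) : set (borel S)).
  by apply/measurableC/bigcupT_measurable => n; exact: borel_order_itv.
apply/lee_addgt0Pr => e e0; rewrite add0e.
have [N] := ltr_add_invr (y := 0%R) (x := e) e0; rewrite add0r => ne.
apply: (@le_trans _ _ (m (~` order_itv (a N) (b N)))); last first.
  by apply: le_trans (h N) _; rewrite lee_fin ltW.
apply: le_measure; rewrite ?inE//.
- by apply: measurableC; exact: borel_order_itv.
- by apply: subsetC => x xN; exists N.
Qed.

Lemma measure_setC0 dT (T : measurableType dT) (m : {measure set T -> \bar R})
    (A B : set T) : measurable A -> measurable B ->
  m (~` B) = 0 -> m A = m (A `&` B).
Proof.
move=> mA mB B0; rewrite -[in LHS](setUIDK A B) measureU//; last 3 first.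
- exact: measurableI.
- exact: measurableD.
- by apply/seteqP; split => // x [[_ Bx] [_ /(_ Bx)]].
rewrite [X in _ + X](_ : _ = 0) ?adde0//.
apply/eqP; rewrite eq_le measure_ge0 andbT -B0.
apply: le_measure; rewrite ?inE; [exact: measurableD|exact: measurableC|].
by move=> x [].
Qed.

(** By Ulam's theorem both measures are carried by a countable union of order
    intervals, where the semiring generates the Borel sets. *)
Lemma incr_determines m1 m2 : m1 setT < +oo ->
  (forall I, incr I -> m1 I = m2 I) -> m1 ≡μ m2.
Proof.
move=> h1 h12 A mA.
have h2 : m2 setT < +oo by rewrite -h12//; exact: incrT.
have /choice[ab abP] (n : nat) : exists p : S * S,
    [/\ (p.1 <= p.2)%O, m1 (~` order_itv p.1 p.2) <= n.+1%:R^-1%:E &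
     m2 (~` order_itv p.1 p.2) <= n.+1%:R^-1%:E].
  have n0 : (0 < n.+1%:R^-1 :> R)%R by rewrite invr_gt0.
  by have [a [b [? ? ?]]] := ulam_order_itv2 h1 h2 n0; exists (a, b).
set U := \bigcup_n order_itv (ab n).1 (ab n).2.
have mU : measurable (U : set (borel S)).
  by apply: bigcupT_measurable => n; exact: borel_order_itv.
rewrite (@measure_setC0 _ _ m1 A U)//; last first.
  by apply: bigcup_order_itv_null => n; have [] := abP n.
rewrite (@measure_setC0 _ _ m2 A U)//; last first.
  by apply: bigcup_order_itv_null => n; have [] := abP n.
apply: (g_sigma_algebra_measure_unique (@incr_decr d S) _ (fun=> setT)).
- exact: incr_decr_measurable.
- by move=> _; exact/incr_decr_incr/incrT.
- by apply/seteqP; split => // x _; exists 0%N.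
- exact: incr_decrI.
- move=> _ [I [D [iI dD ->]]].
  have DE : I `&` D = I `\` (I `&` ~` D).
    apply/seteqP; split => x [Ix Dx]; split => //; first by case.
  by apply: contrapT => nD; exact: Dx.
  have iID : incr (I `&` ~` D) by apply: incrI => //; exact: decrC.
  have mI : measurable I by case: iI.
  have mID : measurable (I `&` ~` D) by case: iID.
  rewrite DE !measureD//.
  + by rewrite setIA setIid; congr (_ - _); exact: h12.
  + exact: (measure_lt_pinfty h2 mI).
  + exact: (measure_lt_pinfty h1 mI).
- by move=> _; exact: h1.
- by apply: (borel_trace_bigcup hle hcompact hd hS) => // n; have [] := abP n.
Qed.

End determination.

(** * Limits along increasing sets *)

Section incr_decr_semiring.
Context (d : Order.disp_t) (S : POrderedPointedTopological.type d).

(** A copy of S whose measurable sets are those of the semiring, kept apart from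
    the Borel structure. *)
Definition incr_decr_type : Type := S.

HB.instance Definition _ := Pointed.copy incr_decr_type S.

Definition incr_decr_display : measure_display.
Proof. exact. Qed.

HB.instance Definition _ := @isSemiRingOfSets.Build incr_decr_display
  incr_decr_type (@incr_decr d S) (@incr_decr0 d S) (@incr_decrI d S)
  (@incr_decrD d S).

End incr_decr_semiring.

Section limit.
Local Open Scope ring_scope.
Context (R : realType) (d : Order.disp_t)
  (S : POrderedPointedTopological.type d).
Hypothesis hle : closed_rel (@le_rel d S).
Hypothesis hcompact : forall A : set S, compact A <-> closed A /\ order_bounded A.
Context (dist : S -> S -> R).
Hypothesis hd : complete_metric dist.
Hypothesis hS : separable S.
Context (mu : nat -> {measure set (borel S) -> \bar R}).
Hypothesis muT : forall n, mu n setT = 1%E.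

Definition incr_close (e : R) (m1 m2 : {measure set (borel S) -> \bar R}) :=
  forall I, incr I -> (m1 I <= m2 I + e%:E)%E /\ (m2 I <= m1 I + e%:E)%E.

Hypothesis mu_cauchy : forall e : R, 0 < e ->
  exists N, forall n, (N <= n)%N -> incr_close e (mu n) (mu N).
Hypothesis mu_tight : forall e : R, 0 < e ->
  exists a b : S, (a <= b)%O /\ forall n, (mu n (~` order_itv a b) <= e%:E)%E.

Let f n A := fine (mu n A).

Let fE n A : measurable A -> mu n A = (f n A)%:E.
Proof.
move=> mA; rewrite fineK// ge0_fin_numE//.
by apply: measure_lt_pinfty mA => //; rewrite muT ltry.
Qed.

Let f_ge0 n A : 0 <= f n A.
Proof. exact: fine_ge0. Qed.

Let f_le n A B : measurable A -> measurable B -> A `<=` B -> f n A <= f n B.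
Proof.
by move=> mA mB AB; rewrite -lee_fin -!fE//; apply: le_measure; rewrite ?inE.
Qed.

Let f_leU n A B : measurable A -> measurable B -> f n (A `|` B) <= f n A + f n B.
Proof.
move=> mA mB; rewrite -lee_fin EFinD -!fE//; last exact: measurableU.
exact: measureU2.
Qed.

Let fD n A B : measurable A -> measurable B ->
  f n (A `\` B) = f n A - f n (A `&` B).
Proof.
move=> mA mB; apply: EFin_inj; rewrite EFinB -!fE//.
- by rewrite measureD//; apply: measure_lt_pinfty => //; rewrite muT ltry.
- exact: measurableI.
- exact: measurableD.
Qed.

Let fC n A : measurable A -> f n (~` A) = 1 - f n A.
Proof. by move=> mA; rewrite -setTD fD// setTI /f muT. Qed.

Let f_cauchy (e : R) : 0 < e -> exists N, forall n, (N <= n)%N -> forall I,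
  incr I -> `|f n I - f N I| <= e.
Proof.
move=> /mu_cauchy[N hN]; exists N => n Nn I iI.
have [mI _] := iI; have := hN _ Nn _ iI.
by rewrite !fE// -!EFinD !lee_fin => -[? ?]; rewrite ler_norml; lra.
Qed.

Let f_cauchy_decr (e : R) : 0 < e -> exists N, forall n, (N <= n)%N -> forall I,
  decr I -> `|f n I - f N I| <= e.
Proof.
move=> /f_cauchy[N hN]; exists N => n Nn I iI.
have [mI _] := iI; have := hN _ Nn _ (decrC iI).
by rewrite !fC// !ler_norml; lra.
Qed.

(** The closed set is the upward closure of a compact subset of I chosen for a
    single measure of the sequence.  It is an upset as well, so the uniform
    Cauchy condition transfers the approximation to all later measures. *)
Let inner_upset (r : S -> S -> Prop) :
  (forall x, r x x) -> (forall x y z, r x y -> r y z -> r x z) -> closed_rel r ->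
  (forall e : R, 0 < e -> exists N, forall n, (N <= n)%N ->
    forall I : set (borel S), measurable I /\ upset r I -> `|f n I - f N I| <= e) ->
  forall (I : set (borel S)) (e : R), measurable I /\ upset r I -> 0 < e ->
  exists F : set S, [/\ closed F, upset r F, F `<=` I &
    \forall n \near \oo, f n (I `\` F) <= e].
Proof.
move=> rr tr cr hC I e [mI uI] e0; have e30 : 0 < e / 3 by rewrite divr_gt0.
have [N hN] := hC _ e30.
have muNT : (mu N setT < +oo)%E by rewrite muT ltry.
have [K [cK KI mK]] := inner_regular_compact hd hS muNT mI e30.
have clF : closed (upclosure r K) by exact: closed_upclosure.
have mF : measurable (upclosure r K : set (borel S)) by exact: closed_borel.
have uF : upset r (upclosure r K) by exact: upset_upclosure.
have FI : upclosure r K `<=` I by exact: upclosure_sub.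
exists (upclosure r K); split => //; exists N => // n /= Nn.
have := hN _ Nn _ (conj mI uI); have := hN _ Nn _ (conj mF uF).
have fDF k : f k (I `\` upclosure r K) = f k I - f k (upclosure r K).
  by rewrite fD// setIC setIidl.
have : f N (I `\` upclosure r K) <= e / 3.
  rewrite -lee_fin -fE; last exact: measurableD.
  apply: le_trans mK; apply: le_measure; rewrite ?inE.
  - exact: measurableD.
  - apply: measurableD => //; apply: closed_borel.
    by move: cK => /hcompact[].
  - by apply: setDS; exact: sub_upclosure.
rewrite !fDF !ler_norml; lra.
Qed.

Let inner_incr (I : set (borel S)) (e : R) : incr I -> 0 < e ->
  exists F : set S,
    [/\ closed F, F `<=` I & \forall n \near \oo, f n (I `\` F) <= e].
Proof.
move=> iI e0.
have [||||F [cF _ FI hF]] := @inner_upset (@le_rel d S) _ _ _ _ I e iI e0.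
- by move=> x; rewrite /le_rel.
- by move=> x y z; exact: le_trans.
- exact: hle.
- exact: f_cauchy.
- by exists F.
Qed.

Let inner_decr (I : set (borel S)) (e : R) : decr I -> 0 < e ->
  exists F : set S,
    [/\ closed F, F `<=` I & \forall n \near \oo, f n (I `\` F) <= e].
Proof.
move=> iI e0.
have [||||F [cF _ FI hF]] := @inner_upset (@ge_rel d S) _ _ _ _ I e iI e0.
- by move=> x; rewrite /ge_rel.
- by move=> x y z yx zy; exact: le_trans yx.
- exact: closed_rel_flip hle.
- exact: f_cauchy_decr.
- by exists F.
Qed.

(** Tightness cuts the closed approximations down to an order interval, which is
    compact. *)
Let inner_compact A (e : R) : incr_decr A -> 0 < e ->
  exists C : set S, [/\ compact C, closed C, C `<=` A &
    \forall n \near \oo, f n (A `\` C) <= e].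
Proof.
move=> [I [D [iI dD ->]]] e0; have e30 : 0 < e / 3 by rewrite divr_gt0.
have [F [cF FI hF]] := inner_incr iI e30.
have [G [cG GD hG]] := inner_decr dD e30.
have [a [b [ab hab]]] := mu_tight e30.
have [mI _] := iI; have [mD _] := dD.
have mF : measurable (F : set (borel S)) by exact: closed_borel.
have mG : measurable (G : set (borel S)) by exact: closed_borel.
have mab : measurable (order_itv a b : set (borel S)) by exact: borel_order_itv.
have cl : closed (F `&` G `&` order_itv a b).
  by apply: closedI; [exact: closedI|exact: closed_order_itv].
exists (F `&` G `&` order_itv a b); split => //.
- apply: subclosed_compact cl (compact_order_itv hle hcompact ab) _.
  exact: subIsetr.
- by move=> x [[/FI ? /GD ?] _].
near=> n.
have h1 : f n (I `\` F) <= e / 3 by near: n.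
have h2 : f n (D `\` G) <= e / 3 by near: n.
have h3 : f n (~` order_itv a b) <= e / 3.
  by rewrite -lee_fin -fE//; exact: measurableC.
have mIF : measurable (I `\` F) by exact: measurableD.
have mDG : measurable (D `\` G) by exact: measurableD.
have mabC : measurable (~` order_itv a b : set (borel S)) by exact: measurableC.
have := f_leU n mIF mDG; have := f_leU n (measurableU _ _ mIF mDG) mabC.
suff : f n ((I `&` D) `\` (F `&` G `&` order_itv a b)) <=
    f n (I `\` F `|` D `\` G `|` ~` order_itv a b) by lra.
apply: f_le.
- apply: measurableD; first exact: measurableI.
  by apply: measurableI => //; exact: measurableI.
- by apply: measurableU => //; exact: measurableU.
- move=> x [[Ix Dx] nx].
  have [Fx|?] := pselect (F x); last by left; left.
  have [Gx|?] := pselect (G x); last by left; right.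
  by right => abx; exact: nx.
Unshelve. all: by end_near. Qed.

Let outer_open A (e : R) : incr_decr A -> 0 < e ->
  exists U : set S, [/\ open U, A `<=` U & \forall n \near \oo, f n (U `\` A) <= e].
Proof.
move=> [I [D [iI dD ->]]] e0; have e20 : 0 < e / 2 by rewrite divr_gt0.
have [F [cF FI hF]] := inner_decr (incrC iI) e20.
have [G [cG GD hG]] := inner_incr (decrC dD) e20.
have [mI _] := iI; have [mD _] := dD.
have mF : measurable (F : set (borel S)) by exact: closed_borel.
have mG : measurable (G : set (borel S)) by exact: closed_borel.
exists (~` F `&` ~` G); split.
- by apply: openI; exact: closed_openC.
- by move=> x [Ix Dx]; split => [/FI|/GD].
near=> n.
have h1 : f n (~` I `\` F) <= e / 2 by near: n.
have h2 : f n (~` D `\` G) <= e / 2 by near: n.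
have mIF : measurable (~` I `\` F) by apply: measurableD => //; exact: measurableC.
have mDG : measurable (~` D `\` G) by apply: measurableD => //; exact: measurableC.
have := f_leU n mIF mDG.
suff : f n ((~` F `&` ~` G) `\` (I `&` D)) <= f n (~` I `\` F `|` ~` D `\` G).
  lra.
apply: f_le.
- apply: measurableD; last exact: measurableI.
  by apply: measurableI => //; exact: measurableC.
- exact: measurableU.
- move=> x [[Fx Gx] nx].
  have [Ix|?] := pselect (I x); last by left.
  by right; split => // Dx; exact: nx.
Unshelve. all: by end_near. Qed.

Let L (A : set S) : R := lim (f n A @[n --> \oo]).

Let cvg_incr I : incr I -> cvg (f n I @[n --> \oo]).
Proof.
move=> iI; apply/cauchy_cvgP; apply: cauchy_exP => e e0.
have e20 : 0 < e / 2 by rewrite divr_gt0.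
have [N hN] := f_cauchy e20; exists (f N I); exists N => // n /= Nn.
rewrite /ball/= distrC; apply: le_lt_trans (hN _ Nn _ iI) _; lra.
Qed.

(** Expresses the value on the semiring through increasing sets, for which the
    limit is known to exist. *)
Let f_incr_decr n I D : incr I -> decr D ->
  f n (I `&` D) = f n I - f n (I `&` ~` D).
Proof.
move=> iI dD.
have -> : I `&` D = I `\` (I `&` ~` D).
  apply/seteqP; split => x [Ix Dx]; split => //; first by case.
  by apply: contrapT => nD; exact: Dx.
have iID : incr (I `&` ~` D) by apply: incrI => //; exact: decrC.
have mI : measurable I by case: iI.
have mID : measurable (I `&` ~` D) by case: iID.
by rewrite fD// setIA setIid.
Qed.

Let cvgL A : incr_decr A -> f n A @[n --> \oo] --> L A.
Proof.
move=> [I [D [iI dD ->]]].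
suff : cvg (f n (I `&` D) @[n --> \oo]) by [].
have -> : (fun n => f n (I `&` D)) = (fun n => f n I - f n (I `&` ~` D)).
  by apply/funext => n; exact: f_incr_decr.
apply: is_cvgB; apply: cvg_incr => //.
by apply: incrI => //; exact: decrC.
Qed.

Definition incr_decr_limit (A : set (incr_decr_type S)) : \bar R := (L A)%:E.

Let limit_ge0 A : (0 <= incr_decr_limit A)%E.
Proof.
rewrite lee_fin /L; have [c|/dvgP->//] := pselect (cvg (f n A @[n --> \oo])).
by apply: limr_ge => //; apply: nearW => n; exact: f_ge0.
Qed.

Let limit_additive : measure_function.semi_additive incr_decr_limit.
Proof.
move=> F n mF tF mU; rewrite /incr_decr_limit sumEFin; congr EFin.
apply/cvg_lim => //.
have -> : (fun k => f k (\big[setU/set0]_(i < n) F i)) =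
    (fun k => \sum_(i < n) f k (F i)).
  apply/funext => k; have mF' i : measurable (F i : set (borel S)).
    exact: (incr_decr_measurable (mF i)).
  apply: EFin_inj; rewrite -fE; last exact: bigsetU_measurable.
  by rewrite measure_bigsetU// -sumEFin; apply: eq_bigr => i _; exact: fE.
apply: cvg_big => [|i _]; last exact: (cvgL (mF _)).
exact: add_continuous.
Qed.

HB.instance Definition _ := isContent.Build _ _ R incr_decr_limit
  limit_ge0 limit_additive.

Let f_leU_big n M (U : nat -> set S) :
  (forall k, measurable (U k : set (borel S))) ->
  f n (\bigcup_(k in `I_M) U k) <= \sum_(0 <= k < M) f n (U k).
Proof.
move=> mU; rewrite bigcup_mkord; elim: M => [|M IH].
  by rewrite big_ord0 big_geq// /f measure0.
rewrite big_ord_recr/= big_nat_recr//=.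
apply: le_trans (f_leU _ _ _) _ => //; last by rewrite lerD2r.
exact: bigsetU_measurable.
Qed.

(** At a total cost of e, A shrinks to a compact set and each F k grows to an
    open one; finitely many of the open sets suffice, and finite subadditivity
    passes to the limit. *)
Let limit_subadditive : measurable_subset_sigma_subadditive incr_decr_limit.
Proof.
move=> A F mF mA AF; apply/lee_addgt0Pr => e e0.
have e20 : 0 < e / 2 by rewrite divr_gt0.
have [C [cC clC CA hC]] := inner_compact mA e20.
have /choice[U UP] (k : nat) : exists U : set S, [/\ open U, F k `<=` U &
    \forall n \near \oo, f n (U `\` F k) <= e / 2 / (2 ^ k.+1)%:R].
  by apply: (outer_open (mF k)); rewrite divr_gt0.
have := cC; rewrite compact_cover => /(_ nat setT U)[k _|x /CA /AF [k _ Fx]|D _ CD].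
- by have [] := UP k.
- by exists k => //; have [_ + _] := UP k; apply.
pose M := (\max_(k <- D) k).+1.
have CM : C `<=` \bigcup_(k in `I_M) U k.
  move=> x /CD[k /= kD Ux]; exists k => //=; rewrite ltnS.
  exact: leq_bigmax_seq.
have mF' k : measurable (F k : set (borel S)).
  exact: (incr_decr_measurable (mF k)).
have mA' : measurable (A : set (borel S)) by exact: (incr_decr_measurable mA).
have mU k : measurable (U k : set (borel S)) by apply: open_borel; have [] := UP k.
have mC : measurable (C : set (borel S)) by exact: closed_borel.
have hU : \forall n \near \oo, (\bigcap_(k in `I_M)
    [set n | f n (U k `\` F k) <= e / 2 / (2 ^ k.+1)%:R]) n.
  by apply: filter_bigcapII => k _; have [] := UP k.
have sum_e : \sum_(0 <= k < M) (e / 2 / (2 ^ k.+1)%:R) <= e / 2.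
  rewrite -lee_fin -sumEFin; apply: le_trans (epsilon_trick0 xpredT (ltW e20)).
  by apply: nneseries_lim_ge => k _ _; rewrite lee_fin divr_ge0// ltW.
have key : L A <= \sum_(0 <= k < M) L (F k) + e.
  have cvS : \sum_(0 <= k < M) f n (F k) + e @[n --> \oo] -->
      \sum_(0 <= k < M) L (F k) + e.
    apply: cvgD; last exact: cvg_cst.
    apply: cvg_big => [|k _]; last exact: (cvgL (mF _)).
    exact: add_continuous.
  apply: (ler_cvg_to (cvgL mA) cvS); near=> n.
  have h1 : f n (A `\` C) <= e / 2 by near: n.
  have h2 : (\bigcap_(k in `I_M)
    [set n | f n (U k `\` F k) <= e / 2 / (2 ^ k.+1)%:R]) n by near: n.
  have h3 : f n (\bigcup_(k in `I_M) U k) <=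
      \sum_(0 <= k < M) (f n (F k) + e / 2 / (2 ^ k.+1)%:R).
    apply: le_trans (f_leU_big _ _ mU) _; apply: ler_sum_nat => k /andP[_ kM].
    apply: (@le_trans _ _ (f n (F k `|` (U k `\` F k)))).
      apply: f_le => //; first by apply: measurableU => //; exact: measurableD.
      by move=> x Ux; have [?|?] := pselect (F k x); [left|right].
    apply: le_trans (f_leU _ _ _) _ => //; first exact: measurableD.
    by rewrite lerD2l; exact: h2.
  rewrite big_split/= in h3.
  have h4 : f n A <= f n (A `\` C) + f n (\bigcup_(k in `I_M) U k).
    apply: le_trans (f_leU _ _ _); last 2 first.
    - exact: measurableD.
    - exact: bigcup_measurable.
    apply: f_le => //.
      by apply: measurableU; [exact: measurableD|exact: bigcup_measurable].
    by move=> x Ax; have [/CM|] := pselect (C x); [right|left].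
  lra.
apply: (@le_trans _ _ (\sum_(0 <= k < M) incr_decr_limit (F k) + e%:E)%E).
  by rewrite sumEFin -EFinD lee_fin.
by apply: leeD => //; apply: nneseries_lim_ge => k _ _; exact: limit_ge0.
Unshelve. all: by end_near. Qed.

HB.instance Definition _ := Content_SigmaSubAdditive_isMeasure.Build _ _ _
  incr_decr_limit limit_subadditive.

(** The extension is a measure on the sigma-algebra generated by the semiring,
    which may miss some Borel sets.  It is carried by a countable union U of
    order intervals, on which the traces of Borel sets do belong to that
    sigma-algebra; its image under a map that fixes U and is constant off U is
    therefore a Borel measure, with the same values on increasing sets. *)
Lemma exists_incr_limit : exists phi : probability (borel S) R,
  forall e : R, 0 < e -> exists N, forall n, (N <= n)%N -> incr_close e (mu n) phi.
Proof.
pose T := g_sigma_algebraType (@measurable _ (incr_decr_type S)).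
pose m : {measure set T -> \bar R} := measure_extension incr_decr_limit.
have mE A : incr_decr A -> m A = (L A)%:E.
  by move=> mA; rewrite /m/= /measure_extension measurable_mu_extE.
have LT : L setT = 1.
  rewrite /L (_ : (fun n => f n setT) = cst 1) ?lim_cst//.
  by apply/funext => n; rewrite /f muT.
have mT : m setT = 1%E by rewrite mE ?LT//; exact/incr_decr_incr/incrT.
have mlt : (m setT < +oo)%E by rewrite mT ltry.
have /choice[ab abP] (n : nat) : exists p : S * S, (p.1 <= p.2)%O /\
    forall k, (mu k (~` order_itv p.1 p.2) <= n.+1%:R^-1%:E)%E.
  have n0 : (0 < n.+1%:R^-1 :> R)%R by rewrite invr_gt0.
  by have [a [b [? ?]]] := mu_tight n0; exists (a, b).
set U := \bigcup_n order_itv (ab n).1 (ab n).2.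
have sI p : <<s @incr_decr d S >> (order_itv p.1 p.2).
  by apply: sub_sigma_algebra; exact: incr_decr_order_itv.
have sU : measurable (U : set T) by apply: bigcupT_measurable => n; exact: sI.
have mU : m (~` (U : set T)) = 0%E.
  apply/eqP; rewrite eq_le measure_ge0 andbT.
  apply/lee_addgt0Pr => e e0; rewrite add0e.
  have [N] := ltr_add_invr (y := 0%R) (x := e) e0; rewrite add0r => ne.
  pose V : set T := order_itv (ab N).1 (ab N).2.
  apply: (@le_trans _ _ (m (~` V))).
    apply: le_measure; rewrite ?inE.
    - exact: measurableC.
    - by apply: measurableC; exact: sI.
    - by apply: subsetC => x xN; exists N.
  have := @measureD _ T _ m setT V measurableT (sI _) mlt.
  rewrite setTI setTD => E0; have {E0}E : m (~` V) = (m setT - m V)%E by exact: E0.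
  rewrite E mT mE; last exact: incr_decr_order_itv.
  rewrite -EFinB lee_fin lerBlDr -lerBlDl.
  apply: limr_ge; first exact: cvgL (incr_decr_order_itv hle _ _).
  apply: nearW => n; have [_ /(_ n)] := abP N.
  have mi : measurable (order_itv (ab N).1 (ab N).2 : set (borel S)).
    exact: borel_order_itv.
  rewrite fE; last exact: measurableC.
  rewrite fC// lee_fin; move: ne; set r := _^-1; lra.
(* U carries all the mass, so any value serves off U *)
pose g (x : T) : borel S := if x \in U then x else point.
have mg : measurable_fun setT g.
  move=> _ B mB; rewrite setTI.
  have -> : g @^-1` B = (B `&` U) `|` ((~` U) `&` (g @^-1` B)).
    apply/seteqP; split => x /=.
      rewrite /g; case: ifPn => [/set_mem ? ?|/negP xU ?]; first by left.
      by right; split => // Ux; apply: xU; exact: mem_set.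
    by move=> [[Bx Ux]|[]//]; rewrite /g mem_set.
  apply: measurableU.
    by apply: (borel_trace_bigcup hle hcompact hd hS) => // n; have [] := abP n.
  have [Bp|nBp] := pselect (B point).
    rewrite (_ : _ `&` _ = ~` U); first exact: measurableC.
    apply/seteqP; split => [x []//|x nUx]; split => //; rewrite /g/=.
    by case: ifPn => // /set_mem.
  rewrite (_ : _ `&` _ = set0)//.
  apply/seteqP; split => // x [nUx]; rewrite /g/=.
  by case: ifPn => [/set_mem//|_].
have mgB (B : set (borel S)) : measurable B -> measurable (g @^-1` B).
  by move=> mB; rewrite -[X in measurable X]setTI; exact: mg.
pose phi0 : {measure set (borel S) -> \bar R} :=
  measure_function_pushforward__canonical__measure_function_Measure m mg.
have phiE (A : set (borel S)) : phi0 A = m (g @^-1` A) by [].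
have phiT : phi0 setT = 1%E by rewrite phiE preimage_setT.
have phiI I : incr I -> phi0 I = (L I)%:E.
  move=> iI; rewrite phiE -mE; last exact: incr_decr_incr.
  have mI : measurable (I : set T).
    by apply: sub_sigma_algebra; exact: incr_decr_incr.
  have mgI : measurable (g @^-1` I) by apply: mgB; case: iI.
  rewrite (measure_setC0 mgI sU mU) (measure_setC0 mI sU mU).
  congr (m _); apply/seteqP; split => x [+ Ux]; rewrite /g/= mem_set//.
have [phi phiP] := probability_of_measure phiT.
exists phi => e e0; have e20 : 0 < e / 2 by rewrite divr_gt0.
have [N hN] := f_cauchy e20; exists N => n Nn I iI.
have mI : measurable I by case: iI.
have -> : (phi : {measure set (borel S) -> \bar R}) I = (L I)%:E.
  by rewrite -phiI//; exact: phiP.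
rewrite fE// -!EFinD !lee_fin.
have hn := hN _ Nn _ iI.
have LN1 : L I <= f N I + e / 2.
  apply: limr_le; first exact: cvg_incr.
  by exists N => // k /= Nk; have := hN _ Nk _ iI; rewrite ler_norml; lra.
have LN2 : f N I - e / 2 <= L I.
  apply: limr_ge; first exact: cvg_incr.
  by exists N => // k /= Nk; have := hN _ Nk _ iI; rewrite ler_norml; lra.
by move: hn; rewrite ler_norml; lra.
Qed.

End limit.

(** * Integration against probability kernels *)

Section kernel_precomp.
Local Open Scope ereal_scope.
Context d0 d1 d2 (T0 : measurableType d0) (T1 : measurableType d1)
  (T2 : measurableType d2) (R : realType).
Context (g : T0 -> T1) (k : R.-pker T1 ~> T2).

(** Makes a kernel depend on one coordinate of a pair, so that integrals with a
    parameter become integrals against a kernel. *)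
Definition kernel_precomp (mg : measurable_fun [set: T0] g) (x : T0) :
  {measure set T2 -> \bar R} := k (g x).

Hypothesis mg : measurable_fun [set: T0] g.

Let measurable_kernel_precomp U : measurable U ->
  measurable_fun [set: T0] (kernel_precomp mg ^~ U).
Proof.
by move=> mU; exact: (measurableT_comp (measurable_kernel k U mU) mg).
Qed.

HB.instance Definition _ := isKernel.Build _ _ _ _ _ (kernel_precomp mg)
  measurable_kernel_precomp.

Let kernel_precomp_setT x : kernel_precomp mg x setT = 1.
Proof. exact: prob_kernel. Qed.

HB.instance Definition _ := Kernel_isProbability.Build _ _ _ _ _
  (kernel_precomp mg) kernel_precomp_setT.

End kernel_precomp.

Section kernels.
Local Open Scope ereal_scope.
Context d0 d1 d2 (T0 : measurableType d0) (T1 : measurableType d1)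
  (T2 : measurableType d2) (R : realType).

Lemma integral_mkcomp_noparam (k1 : R.-pker T0 ~> T1) (k2 : R.-pker T1 ~> T2) x
    (f : T2 -> \bar R) : (forall z, 0 <= f z) -> measurable_fun setT f ->
  \int[mkcomp_noparam k1 k2 x]_z f z = \int[k1 x]_y \int[k2 y]_z f z.
Proof.
move=> f0 mf.
rewrite -(@integral_kcomp _ _ _ _ _ _ _ k1
  (kernel_precomp k2 (@measurable_snd _ _ T0 T1)))//.
Qed.

Lemma measurable_integral_pker (k : R.-pker T0 ~> T1) (f : T0 * T1 -> \bar R) :
  (forall z, 0 <= f z) -> measurable_fun setT f ->
  measurable_fun setT (fun x => \int[k x]_y f (x, y)).
Proof. by move=> f0 mf; exact: measurable_fun_integral_finite_kernel. Qed.

Lemma integral_kernel_act (phi : probability T0 R) (k : R.-pker T0 ~> T1)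
    (f : T1 -> \bar R) : (forall z, 0 <= f z) -> measurable_fun setT f ->
  \int[kernel_act phi k]_z f z = \int[phi]_y \int[k y]_z f z.
Proof.
move=> f0 mf.
have mphi : measurable_fun [set: T0] (cst phi : T0 -> pprobability T0 R).
  exact: measurable_cst.
by rewrite -[RHS](@integral_kcomp _ _ _ _ _ _ _ (kprobability mphi)
  (kernel_precomp k (@measurable_snd _ _ T0 T0)) point).
Qed.

End kernels.

(** The values of a probability kernel are bare measures of mass one; replacing
    them by probabilities brings them under Tonelli's theorem. *)
Lemma integral_swap d0 d1 (T0 : measurableType d0) (T1 : measurableType d1)
    (R : realType) (m1 : {measure set T0 -> \bar R})
    (m2 : {measure set T1 -> \bar R}) (f : T0 * T1 -> \bar R) :
  (m1 setT = 1 -> m2 setT = 1 -> (forall z, 0 <= f z) -> measurable_fun setT f ->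
  \int[m1]_x \int[m2]_y f (x, y) = \int[m2]_y \int[m1]_x f (x, y))%E.
Proof.
move=> /probability_of_measure[p1 p1E] /probability_of_measure[p2 p2E] f0 mf.
have E1 (h : T0 -> \bar R) : (\int[m1]_x h x = \int[p1]_x h x)%E.
  by apply: eq_measure_integral => A _ _; rewrite -p1E.
have E2 (h : T1 -> \bar R) : (\int[m2]_x h x = \int[p2]_x h x)%E.
  by apply: eq_measure_integral => A _ _; rewrite -p2E.
rewrite E1 E2; under eq_integral do rewrite E2.
under [RHS]eq_integral do rewrite E1.
exact: fubini_tonelli.
Qed.

Section kernel_pow.
Local Open Scope ereal_scope.
Context (R : realType) d (T : measurableType d) (P : R.-pker T ~> T).
Implicit Types (f : T -> \bar R) (x : T).

Lemma integral_kernel_pow0 x f : measurable_fun setT f ->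
  \int[kernel_pow P 0 x]_y f y = f x.
Proof. by move=> mf; rewrite /= /kdirac integral_dirac// diracT mul1e. Qed.

Lemma integral_kernel_powS t x f : (forall z, 0 <= f z) -> measurable_fun setT f ->
  \int[kernel_pow P t.+1 x]_y f y = \int[P x]_y \int[kernel_pow P t y]_z f z.
Proof. by move=> f0 mf; rewrite integral_mkcomp_noparam. Qed.

Lemma measurable_integral_kernel_pow t f :
  (forall z, 0 <= f z) -> measurable_fun setT f ->
  measurable_fun setT (fun x => \int[kernel_pow P t x]_y f y).
Proof.
move=> f0 mf; apply: measurable_fun_integral_kernel => // U mU.
exact: measurable_kernel.
Qed.

Lemma integral_kernel_powD s t x f :
  (forall z, 0 <= f z) -> measurable_fun setT f ->
  \int[kernel_pow P (s + t) x]_y f y =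
  \int[kernel_pow P s x]_y \int[kernel_pow P t y]_z f z.
Proof.
move=> f0 mf; elim: s x => [|s IH] x.
  by rewrite integral_kernel_pow0//; exact: measurable_integral_kernel_pow.
rewrite addSn !integral_kernel_powS//.
- by apply: eq_integral => y _; rewrite IH.
- by move=> y; exact: integral_ge0.
- exact: measurable_integral_kernel_pow.
Qed.

End kernel_pow.

Section pair_op.
Local Open Scope ereal_scope.
Context (R : realType) d (T : measurableType d).
Implicit Types (k : R.-pker T ~> T) (f g : T * T -> \bar R) (z : T * T).

(** Expectation of f after the two coordinates of z have moved independently
    according to k. *)
Definition pair_op k f z := \int[k z.1]_y \int[k z.2]_y' f (y, y').

Lemma pair_op_ge0 k f z : (forall z, 0 <= f z) -> 0 <= pair_op k f z.
Proof. by move=> f0; apply: integral_ge0 => y _; exact: integral_ge0. Qed.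

Let measurable_shuffle : measurable_fun [set: (T * T) * T]
  (fun p : (T * T) * T => (p.1.2, p.2)).
Proof.
apply: measurable_fun_pair => //.
exact: measurableT_comp.
Qed.

Lemma measurable_inner k f : (forall z, 0 <= f z) -> measurable_fun setT f ->
  measurable_fun setT (fun p : T * T => \int[k p.1]_y' f (p.2, y')).
Proof.
move=> f0 mf.
apply: (@measurable_integral_pker _ _ _ _ _
  (kernel_precomp k (@measurable_fst _ _ T T)) (fun p => f (p.1.2, p.2))) => //.
exact: measurableT_comp mf measurable_shuffle.
Qed.

Lemma measurable_inner1 k f x : (forall z, 0 <= f z) -> measurable_fun setT f ->
  measurable_fun setT (fun y => \int[k x]_y' f (y, y')).
Proof.
move=> f0 mf.
exact: (measurableT_comp (measurable_inner k f0 mf) (pair1_measurable x)).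
Qed.

Lemma measurable_pair_op k f : (forall z, 0 <= f z) -> measurable_fun setT f ->
  measurable_fun setT (pair_op k f).
Proof.
move=> f0 mf.
apply: (@measurable_integral_pker _ _ _ _ _
  (kernel_precomp k (@measurable_fst _ _ T T))
  (fun p : T * T * T => \int[k p.1.2]_y' f (p.2, y'))) => //.
  by move=> p; exact: integral_ge0.
exact: (measurableT_comp (measurable_inner k f0 mf) measurable_shuffle).
Qed.

Lemma measurable_section1 f x : measurable_fun setT f ->
  measurable_fun setT (fun y => f (x, y)).
Proof. by move=> mf; exact: (measurableT_comp mf (pair1_measurable x)). Qed.

Lemma le_pair_op k f g z : (forall z, 0 <= f z) -> measurable_fun setT f ->
  measurable_fun setT g -> (forall z, f z <= g z) -> pair_op k f z <= pair_op k g z.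
Proof.
move=> f0 mf mg fg; have g0 u : 0 <= g u by exact: le_trans (f0 u) (fg u).
apply: ge0_le_integral => //; try exact: measurable_inner1.
  by move=> y _; exact: integral_ge0.
by move=> y _; apply: ge0_le_integral => //; exact: measurable_section1.
Qed.

Lemma pair_op_comb k f g (a b : R) z : (0 <= a)%R -> (0 <= b)%R ->
  (forall z, 0 <= f z) -> measurable_fun setT f ->
  (forall z, 0 <= g z) -> measurable_fun setT g ->
  pair_op k (fun u => a%:E * f u + b%:E * g u) z =
  a%:E * pair_op k f z + b%:E * pair_op k g z.
Proof.
move=> a0 b0 f0 mf g0 mg.
rewrite /pair_op.
transitivity (\int[k z.1]_y (a%:E * (\int[k z.2]_y' f (y, y')) +
    b%:E * (\int[k z.2]_y' g (y, y')))).
  apply: eq_integral => y _; rewrite ge0_integralD//.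
  - by rewrite !ge0_integralZl//; exact: measurable_section1.
  - by move=> y' _; rewrite mule_ge0.
  - by apply: measurable_funeM; exact: measurable_section1.
  - by move=> y' _; rewrite mule_ge0.
  - by apply: measurable_funeM; exact: measurable_section1.
rewrite ge0_integralD//.
- rewrite !ge0_integralZl//; try exact: measurable_inner1.
  + by move=> y _; exact: integral_ge0.
  + by move=> y _; exact: integral_ge0.
- by move=> y _; rewrite mule_ge0//; exact: integral_ge0.
- by apply: measurable_funeM; exact: measurable_inner1.
- by move=> y _; rewrite mule_ge0//; exact: integral_ge0.
- by apply: measurable_funeM; exact: measurable_inner1.
Qed.

Lemma pair_op_cst k (r : \bar R) z : pair_op k (cst r) z = r.
Proof.
rewrite /pair_op; under eq_integral do rewrite integral_cst// prob_kernel mule1.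
by rewrite integral_cst// prob_kernel mule1.
Qed.

Lemma pair_op_fst k (h : T -> \bar R) z :
  pair_op k (fun u => h u.1) z = \int[k z.1]_y h y.
Proof.
apply: eq_integral => y _ /=.
by rewrite integral_cst// prob_kernel mule1.
Qed.

Lemma pair_op_snd k (h : T -> \bar R) z :
  pair_op k (fun u => h u.2) z = \int[k z.2]_y h y.
Proof. by rewrite /pair_op /= integral_cst// prob_kernel mule1. Qed.

Lemma pair_op_kernel_pow0 (P : R.-pker T ~> T) f z : (forall z, 0 <= f z) ->
  measurable_fun setT f -> pair_op (kernel_pow P 0) f z = f z.
Proof.
move=> f0 mf; rewrite /pair_op integral_kernel_pow0.
  by rewrite integral_kernel_pow0; [case: z|exact: measurable_section1].
exact: measurable_inner1.
Qed.

(** Chapman-Kolmogorov equation of the product kernel: the last t steps of the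
    first chain are exchanged with the first step of the second one. *)
Lemma pair_op_kernel_powS (P : R.-pker T ~> T) t f z : (forall z, 0 <= f z) ->
  measurable_fun setT f ->
  pair_op (kernel_pow P t.+1) f z = pair_op P (pair_op (kernel_pow P t) f) z.
Proof.
move=> f0 mf; set Pt := kernel_pow P t.
rewrite /pair_op integral_kernel_powS; last 2 first.
- by move=> y; exact: integral_ge0.
- exact: measurable_inner1.
apply: eq_integral => y _.
transitivity (\int[Pt y]_w \int[P z.2]_v (\int[Pt v]_y' f (w, y'))).
  apply: eq_integral => w _; rewrite integral_kernel_powS//.
  exact: measurable_section1.
apply: (@integral_swap _ _ _ _ _ (Pt y) (P z.2)
  (fun p : T * T => \int[Pt p.2]_y' f (p.1, y'))).
- exact: prob_kernel.
- exact: prob_kernel.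
- by move=> p; exact: integral_ge0.
- exact: (measurableT_comp (measurable_inner Pt f0 mf) (@measurable_swap _ _ T T)).
Qed.

End pair_op.

(** * The coupling bound *)

Section not_le.
Context (d : Order.disp_t) (S : POrderedPointedTopological.type d).

Definition not_le : set (borel S * borel S) := [set z | ~ le_rel (z.1 : S) z.2].

Context (R : realType) (dist : S -> S -> R).
Hypothesis hd : complete_metric dist.
Hypothesis hS : separable S.
Hypothesis hle : closed_rel (@le_rel d S).

(** Since the order is closed, an unordered pair has around it a product of two
    balls of the countable base that contains no ordered pair. *)
Lemma measurable_not_le : measurable not_le.
Proof.
have [c cb] := countable_base_dist hd hS (ex_intro _ point I).
pose B (p : nat * nat) : set (borel S) := [set y | dist (c p.1) y <= p.2.+1%:R^-1].
have mB p : measurable (B p) by apply: closed_borel; exact: closed_ball_dist.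
have -> : not_le = \bigcup_(p : (nat * nat) * (nat * nat))
    (if pselect (B p.1 `*` B p.2 `<=` not_le) then B p.1 `*` B p.2 else set0).
  apply/seteqP; split => [[x y] nxy|z [p _]]; last by case: pselect => // h /h.
  have /= := hle nxy => -[[U V] [/= xU yV] UV].
  have [i [n [ix iU]]] := cb _ _ xU; have [j [m [jy jV]]] := cb _ _ yV.
  exists ((i, n), (j, m)) => //; case: pselect => [h|] /=.
    by split; rewrite /B/= ltW.
  by case=> -[u v] [/= Bu Bv]; apply: (UV (u, v)); split; [exact: iU|exact: jV].
apply: countable_bigcupT_measurable => [|p]; first exact: countableP.
by case: pselect => h /=; [exact: measurableX|exact: measurable0].
Qed.

End not_le.

Section monotone_integrals.
Local Open Scope ereal_scope.
Context (R : realType) (d : Order.disp_t)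
  (S : POrderedPointedTopological.type d).

Definition incr01 (h : borel S -> \bar R) :=
  [/\ measurable_fun setT h, forall x, 0 <= h x, forall x, h x <= 1 &
    forall x y : S, (x <= y)%O -> h x <= h y].

Definition decr01 (h : borel S -> \bar R) :=
  [/\ measurable_fun setT h, forall x, 0 <= h x, forall x, h x <= 1 &
    forall x y : S, (x <= y)%O -> h y <= h x].

Lemma integral_le1 d' (T : measurableType d') (m : {measure set T -> \bar R})
    (h : T -> \bar R) : m setT = 1 -> measurable_fun setT h ->
  (forall x, 0 <= h x) -> (forall x, h x <= 1) -> \int[m]_x h x <= 1.
Proof.
move=> m1 mh h0 h1; apply: (@le_trans _ _ (\int[m]_x cst 1 x)).
  by apply: ge0_le_integral.
by rewrite integral_cst// m1 mule1.
Qed.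

Lemma fin_num01 (x : \bar R) : 0 <= x -> x <= 1 -> x \is a fin_num.
Proof. by move=> x0 x1; rewrite ge0_fin_numE// (le_lt_trans x1)// ltry. Qed.

Lemma onem_ge0 (x : \bar R) : 0 <= x -> x <= 1 -> 0 <= 1 - x.
Proof.
move=> x0 x1; move: (x0) (x1); rewrite -(fineK (fin_num01 x0 x1)).
by rewrite -EFinB !lee_fin subr_ge0.
Qed.

Lemma onem_le1 (x : \bar R) : 0 <= x -> x <= 1 -> 1 - x <= 1.
Proof.
move=> x0 x1; move: (x0) (x1); rewrite -(fineK (fin_num01 x0 x1)).
by rewrite -EFinB !lee_fin lerBlDr lerDl.
Qed.

Context (P : R.-pker borel S ~> borel S).
Hypothesis hinc : increasing_kernel P.

Lemma incr01_integral h (x y : S) : incr01 h -> (x <= y)%O ->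
  \int[P x]_z h z <= \int[P y]_z h z.
Proof.
move=> [mh h0 h1 hh] xy.
have hfin z : h z \is a fin_num by exact: fin_num01.
have ib : ibS (fine \o h).
  split => [||u v uv /=].
  - exact: measurableT_comp.
  - exists 1%R => z /=; rewrite ger0_norm ?fine_ge0//.
    by rewrite -lee_fin fineK.
  - by rewrite fine_le// hh.
have := hinc xy ib; rewrite /Rintegral.
have E u : \int[P u]_z (((fine \o h) z)%:E) = \int[P u]_z h z.
  by apply: eq_integral => z _ /=; rewrite fineK.
rewrite !E -lee_fin !fineK//; apply: fin_num01; try exact: integral_ge0.
- by apply: integral_le1 => //; exact: prob_kernel.
- by apply: integral_le1 => //; exact: prob_kernel.
Qed.

Lemma integral_onem (m : {measure set (borel S) -> \bar R})
    (h : borel S -> \bar R) :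
  m setT = 1 -> measurable_fun setT h ->
  (forall x, 0 <= h x) -> (forall x, h x <= 1) ->
  \int[m]_x h x = 1 - \int[m]_x (1 - h x).
Proof.
move=> m1 mh h0 h1.
have k0 x : 0 <= 1 - h x by exact: onem_ge0.
have k1 x : 1 - h x <= 1 by exact: onem_le1.
have mk : measurable_fun setT (fun x => 1 - h x).
  by apply: emeasurable_funB => //; exact: measurable_cst.
have : \int[m]_x h x + \int[m]_x (1 - h x) = 1.
  rewrite -ge0_integralD//.
  rewrite -[RHS]m1 -[RHS]mul1e -integral_cst//; apply: eq_integral => x _ /=.
  by rewrite addeC subeK// fin_num01.
have : \int[m]_x (1 - h x) \is a fin_num.
  by apply: fin_num01; [exact: integral_ge0|exact: integral_le1].
by move=> kf e; rewrite -[X in _ = X - _]e addeK.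
Qed.

Lemma decr01_integral h (x y : S) : decr01 h -> (x <= y)%O ->
  \int[P y]_z h z <= \int[P x]_z h z.
Proof.
move=> [mh h0 h1 hh] xy.
rewrite (@integral_onem (P x) h)//; last exact: prob_kernel.
rewrite (@integral_onem (P y) h)//; last exact: prob_kernel.
apply: leeB => //; apply: incr01_integral => //; split => //.
- by apply: emeasurable_funB => //; exact: measurable_cst.
- by move=> z; exact: onem_ge0.
- by move=> z; exact: onem_le1.
- by move=> u v uv; apply: leeB => //; exact: hh.
Qed.

Lemma incr01_kernel_pow t h : incr01 h ->
  incr01 (fun x => \int[kernel_pow P t x]_y h y).
Proof.
move=> ih; have [mh h0 h1 hh] := ih; split.
- exact: measurable_integral_kernel_pow.
- by move=> x; exact: integral_ge0.
- by move=> x; apply: integral_le1 => //; exact: prob_kernel.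
- elim: t h ih {mh h0 h1 hh} => [|t IH] h ih x y xy; have [mh h0 h1 hh] := ih.
    by rewrite !integral_kernel_pow0// hh.
  rewrite !integral_kernel_powS//; apply: incr01_integral => //; split.
  + exact: measurable_integral_kernel_pow.
  + by move=> z; exact: integral_ge0.
  + by move=> z; apply: integral_le1 => //; exact: prob_kernel.
  + exact: IH.
Qed.

(** The direction in which [not_le] grows: raising the first point and lowering
    the second makes the pair harder to order. *)
Definition mono01 (f : borel S * borel S -> \bar R) :=
  [/\ measurable_fun setT f, forall z, 0 <= f z, forall z, f z <= 1 &
    forall x x' y y' : S, (x <= y)%O -> (y' <= x')%O -> f (x, x') <= f (y, y')].

Lemma pair_op_le1 (k : R.-pker borel S ~> borel S) f z :
  measurable_fun setT f -> (forall z, 0 <= f z) -> (forall z, f z <= 1) ->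
  pair_op k f z <= 1.
Proof.
move=> mf f0 f1; rewrite -[leRHS](pair_op_cst k 1 z).
by apply: le_pair_op => //; exact: measurable_cst.
Qed.

Lemma mono01_pair_op f : mono01 f -> mono01 (pair_op P f).
Proof.
move=> [mf f0 f1 hf]; split.
- exact: measurable_pair_op.
- by move=> z; exact: pair_op_ge0.
- by move=> z; exact: pair_op_le1.
- move=> x x' y y' xy y'x'.
  apply: (@le_trans _ _ (pair_op P f (y, x'))).
    apply: incr01_integral => //=; split.
    + exact: measurable_inner1.
    + by move=> u; exact: integral_ge0.
    + move=> u; apply: integral_le1 => //; first exact: prob_kernel.
      exact: measurable_section1.
    + move=> u v uv; apply: ge0_le_integral => //; try exact: measurable_section1.
      by move=> w _; exact: hf.
  apply: ge0_le_integral => //=; try exact: measurable_inner1.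
    by move=> w _; exact: integral_ge0.
  move=> w _; apply: decr01_integral => //; split => //.
  + exact: measurable_section1.
  + by move=> u v uv; exact: hf.
Qed.

Lemma mono01_pair_op_pow t f : mono01 f -> mono01 (pair_op (kernel_pow P t) f).
Proof.
elim: t => [|t IH] mf; have [? f0 ? ?] := mf.
  have -> : pair_op (kernel_pow P 0) f = f.
    by apply/funext => z; exact: pair_op_kernel_pow0.
  by [].
have -> : pair_op (kernel_pow P t.+1) f = pair_op P (pair_op (kernel_pow P t) f).
  by apply/funext => z; exact: pair_op_kernel_powS.
exact/mono01_pair_op/IH.
Qed.

Hypothesis mM : measurable (@not_le d S).

Definition not_le_indic (z : borel S * borel S) : \bar R := (\1_(@not_le d S) z)%:E.

(** Probability that independent chains started at the two coordinates of the
    pair satisfy X_s <= X'_s at no time s <= t. *)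
Fixpoint not_crossed t : borel S * borel S -> \bar R :=
  if t is t'.+1 then fun z => not_le_indic z * pair_op P (not_crossed t') z
  else not_le_indic.

Lemma mono01_not_le_indic : mono01 not_le_indic.
Proof.
split.
- by apply/measurable_EFinP; exact: measurable_indic.
- by move=> z; rewrite lee_fin.
- by move=> z; rewrite lee_fin indicE; case: (_ \in _).
- move=> x x' y y' xy yx; rewrite lee_fin !indicE ler_nat.
  have [/set_mem nx|//] := boolP ((x, x') \in _).
  rewrite mem_set// => h; apply: nx; rewrite /le_rel /=.
  exact: le_trans xy (le_trans h yx).
Qed.

Lemma not_le_indicP z : not_le_indic z = 0 /\ le_rel (z.1 : S) z.2 \/
  not_le_indic z = 1 /\ not_le z.
Proof.
rewrite /not_le_indic indicE.
have [/set_mem nz|/negP nz] := boolP (z \in _); first by right.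
by left; split => //; apply: contrapT => h; apply: nz; rewrite inE.
Qed.

Lemma mono01_not_crossed t : mono01 (not_crossed t).
Proof.
elim: t => [|t IH]; first exact: mono01_not_le_indic.
have [mq q0 q1 hq] := mono01_pair_op IH; have [m0 c0 c1 hc] := mono01_not_le_indic.
split => /=.
- exact: emeasurable_funM.
- by move=> z; rewrite mule_ge0.
- by move=> z; rewrite -[leRHS]mul1e lee_pmul.
- by move=> x x' y y' xy yx; rewrite lee_pmul ?hq ?hc.
Qed.

Lemma not_crossed_le_indic t z : not_crossed t z <= not_le_indic z.
Proof.
case: t => [//|t] /=; have [mq q0 q1 hq] := mono01_pair_op (mono01_not_crossed t).
have [m0 c0 c1 hc] := mono01_not_le_indic.
by rewrite -[leRHS]mule1 lee_pmul.
Qed.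

Lemma not_crossed_leS t z : not_crossed t.+1 z <= not_crossed t z.
Proof.
elim: t z => [|t IH] z; first exact: not_crossed_le_indic.
have [m0 c0 c1 hc] := mono01_not_le_indic.
have [m1 d0 d1 _] := mono01_not_crossed t.+1.
have [m2 e0 e1 _] := mono01_not_crossed t.
rewrite [leLHS]/= [leRHS]/=; apply: lee_pmul => //; first exact: pair_op_ge0.
by apply: le_pair_op => //.
Qed.

(** Forgets the past: chains that have not crossed by time t are in particular
    unordered at time t. *)
Lemma not_crossed_le_pair_op t z :
  not_crossed t z <= pair_op (kernel_pow P t) not_le_indic z.
Proof.
have [m0 c0 c1 hc] := mono01_not_le_indic.
elim: t z => [|t IH] z; first by rewrite pair_op_kernel_pow0.
rewrite pair_op_kernel_powS//=.
have [m2 e0 e1 _] := mono01_not_crossed t.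
have [m3 f0 f1 _] := mono01_pair_op_pow t mono01_not_le_indic.
apply: (@le_trans _ _ (1 * pair_op P (not_crossed t) z)).
  by apply: lee_pmul => //; exact: pair_op_ge0.
by rewrite mul1e; apply: le_pair_op.
Qed.

(** From an ordered pair, monotonicity of the t-step kernel gives the bound
    without error term.  From any other pair, the error term is an average
    over one independent step, and so are both integrals. *)
Lemma coupling t h z : incr01 h ->
  \int[kernel_pow P t z.1]_y h y <=
  \int[kernel_pow P t z.2]_y h y + not_crossed t z.
Proof.
move=> ih; have [mh h0 h1 hh] := ih.
elim: t z => [|t IH] z.
  rewrite !integral_kernel_pow0//=; have [[-> zz]|[-> _]] := not_le_indicP z.
    by rewrite adde0 hh.
  by rewrite (le_trans (h1 _))// leeDr.
have [mt ht0 ht1 hth] := incr01_kernel_pow t ih.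
have [mst hst0 hst1 hsth] := incr01_kernel_pow t.+1 ih.
rewrite [not_crossed _ _]/=; have [[-> zz]|[-> _]] := not_le_indicP z.
  by rewrite mul0e adde0 hsth.
have [m2 e0 e1 _] := mono01_not_crossed t.
rewrite mul1e !integral_kernel_powS//.
rewrite -(pair_op_fst P _ z) -(pair_op_snd P _ z).
have m3 : measurable_fun setT
    (fun u : borel S * borel S => \int[kernel_pow P t u.1]_y h y).
  exact: (measurableT_comp mt (@measurable_fst _ _ _ _)).
have m4 : measurable_fun setT
    (fun u : borel S * borel S => \int[kernel_pow P t u.2]_y h y).
  exact: (measurableT_comp mt (@measurable_snd _ _ _ _)).
have := @pair_op_comb _ _ _ P (fun u => \int[kernel_pow P t u.2]_y h y)
  (not_crossed t) 1 1 z ler01 ler01 (fun u => ht0 u.2) m4 e0 m2.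
rewrite !mul1e => <-; apply: le_pair_op => //.
- by apply: emeasurable_funD; apply: measurable_funeM.
- by move=> u; rewrite !mul1e.
Qed.

Section contraction.
Context (a b : S) (s : nat) (delta : R).
Hypothesis mab : measurable (order_itv a b : set (borel S)).
Hypothesis delta01 : (0 < delta <= 1)%R.
Hypothesis hdelta : pair_op (kernel_pow P s) not_le_indic (b, a) <= (1 - delta)%:E.

Let outside (x : borel S) : \bar R := (\1_(~` order_itv a b) x)%:E.

Let out (z : borel S * borel S) : \bar R := outside z.1 + outside z.2.

Let outside0 x : 0 <= outside x. Proof. by rewrite lee_fin. Qed.

Let moutside : measurable_fun setT outside.
Proof. by apply/measurable_EFinP; apply: measurable_indic; exact: measurableC. Qed.

Let mout1 : measurable_fun setT (fun z : borel S * borel S => outside z.1).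
Proof. exact: (measurableT_comp moutside (@measurable_fst _ _ _ _)). Qed.

Let mout2 : measurable_fun setT (fun z : borel S * borel S => outside z.2).
Proof. exact: (measurableT_comp moutside (@measurable_snd _ _ _ _)). Qed.

Let mout : measurable_fun setT out.
Proof. exact: emeasurable_funD. Qed.

Let out0 z : 0 <= out z.
Proof. by rewrite adde_ge0. Qed.

Let base z : not_crossed s z <= (1 - delta)%:E * not_le_indic z + delta%:E * out z.
Proof.
have /andP[d0 d1] := delta01.
have out_ge1 : ~ (order_itv a b z.1 /\ order_itv a b z.2) -> 1 <= out z.
  move=> nab; rewrite /out /outside !indicE.
  have [/set_mem h1|/negP h1] := boolP (z.1 \in ~` _).
    by rewrite leeDl// lee_fin.
  have [/set_mem h2|/negP h2] := boolP (z.2 \in ~` _).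
    by rewrite leeDr// lee_fin.
  exfalso; apply: nab; split; apply: contrapT => h; [apply: h1|apply: h2];
    exact: mem_set.
have [[z0 _]|[z1 _]] := not_le_indicP z.
  apply: (le_trans (not_crossed_le_indic _ _)).
  by rewrite z0 mule0 add0e mule_ge0// lee_fin ltW.
rewrite z1 mule1.
have [[h1 h2]|/out_ge1 h] := pselect (order_itv a b z.1 /\ order_itv a b z.2).
  apply: (@le_trans _ _ (1 - delta)%:E); last first.
    by rewrite leeDl// mule_ge0// lee_fin ltW.
  apply: le_trans (not_crossed_le_pair_op _ _) _; apply: le_trans hdelta.
  have [_ _ _ hm] := mono01_pair_op_pow s mono01_not_le_indic.
  move: h1 h2 => /andP[ax xb] /andP[ay yb].
  by have := hm z.1 z.2 b a xb ay; rewrite -surjective_pairing.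
have [_ _ q1 _] := mono01_not_crossed s.
apply: (le_trans (q1 _)).
apply: (@le_trans _ _ ((1 - delta)%:E + delta%:E * 1)).
  by rewrite mule1 -EFinD subrK.
by rewrite leeD2l// lee_pmul2l// lte_fin.
Qed.

(** Within the box, (b, a) is the worst starting pair, so chains found in the box
    at time t get ordered in the next s steps with probability at least delta.
    The second term pays for not being in the box at time t. *)
Lemma not_crossed_contraction t z : not_crossed (t + s) z <=
  (1 - delta)%:E * not_crossed t z + delta%:E *
    (kernel_pow P t z.1 (~` order_itv a b) + kernel_pow P t z.2 (~` order_itv a b)).
Proof.
have /andP[dd0 dd1] := delta01.
have d0 : (0 <= delta)%R by rewrite ltW.
have d1 : (0 <= 1 - delta)%R by rewrite subr_ge0.
have [m0 c0 c1 hc] := mono01_not_le_indic.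
have outE u z' : pair_op (kernel_pow P u) out z' =
    kernel_pow P u z'.1 (~` order_itv a b) + kernel_pow P u z'.2 (~` order_itv a b).
  transitivity (1%:E * pair_op (kernel_pow P u) (fun z => outside z.1) z' +
      1%:E * pair_op (kernel_pow P u) (fun z => outside z.2) z').
    rewrite -pair_op_comb//; congr (pair_op _ _ _); apply/funext => v.
    by rewrite !mul1e.
  rewrite !mul1e pair_op_fst pair_op_snd.
  by rewrite !integral_indic ?setIT//; exact: measurableC.
rewrite -outE; elim: t z => [|t IH] z.
  by rewrite pair_op_kernel_pow0.
have [m2 e0 e1 _] := mono01_not_crossed t.
have [m3 f0 f1 _] := mono01_not_crossed (t + s).
rewrite addSn [leLHS]/= [not_crossed t.+1 z]/= pair_op_kernel_powS//.
have po0 u : 0 <= pair_op (kernel_pow P t) out u by exact: pair_op_ge0.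
have mpo : measurable_fun setT (pair_op (kernel_pow P t) out).
  exact: measurable_pair_op.
have h1 : pair_op P (not_crossed (t + s)) z <=
    (1 - delta)%:E * pair_op P (not_crossed t) z +
    delta%:E * pair_op P (pair_op (kernel_pow P t) out) z.
  rewrite -pair_op_comb//; apply: le_pair_op => //.
  by apply: emeasurable_funD; exact: measurable_funeM.
have [[-> _]|[-> _]] := not_le_indicP z; last by rewrite !mul1e.
by rewrite !mul0e mule0 add0e mule_ge0// ?lee_fin//; exact: pair_op_ge0.
Qed.

End contraction.

End monotone_integrals.

(** * Decay of the probability of not crossing *)

Section staircase.
Context (R : realType).

(** The sum is the integer part of t, capped at k. *)
Lemma count_steps (k : nat) (t : R) : 0 <= t ->
  let c := \sum_(j < k) (j.+1%:R <= t)%R%:R in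
  [/\ c <= t, (t <= k%:R -> t <= c + 1) & (k%:R <= t -> c = k%:R)].
Proof.
move=> t0; elim: k => [|k [IH1 IH2 IH3]] /=.
  by rewrite big_ord0; split => // h; rewrite add0r (le_trans h).
rewrite big_ord_recr/=; have [tk|tk] := leP k.+1%:R t.
  have -> : \sum_(i < k) (i.+1%:R <= t)%R%:R = k%:R :> R.
    by apply: IH3; apply: le_trans tk; rewrite ler_nat.
  rewrite /= -natr1; rewrite -natr1 in tk; split => //; lra.
rewrite addr0; split => //.
move=> _; have [h|h] := leP t k%:R; first exact: IH2.
rewrite IH3; last exact: ltW.
by rewrite -natr1 in tk; lra.
Qed.

End staircase.

Section staircase_integral.
Local Open Scope ereal_scope.
Context (R : realType) (d : Order.disp_t)
  (S : POrderedPointedTopological.type d).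

Lemma incr01_indic (I : set (borel S)) : incr I ->
  incr01 (fun x => (\1_I x)%:E : \bar R).
Proof.
move=> [mI uI]; split.
- by apply/measurable_EFinP; exact: measurable_indic.
- by move=> x; rewrite lee_fin.
- by move=> x; rewrite lee_fin indicE; case: (_ \in _).
- move=> x y xy; rewrite lee_fin !indicE ler_nat.
  by have [/set_mem Ix|//] := boolP (x \in I); rewrite mem_set//; exact: uI Ix.
Qed.

(** A layer-cake argument with k steps: h is within 1/k of the average of the
    indicators of the sets where h >= (j+1)/k, for j < k, and these sets are
    increasing. *)
Lemma incr_le_integral (m1 m2 : {measure set (borel S) -> \bar R}) (e : R)
    (h : borel S -> \bar R) : m1 setT = 1 -> m2 setT = 1 -> (0 <= e)%R ->
  (forall I, incr I -> m1 I <= m2 I + e%:E) -> incr01 h ->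
  \int[m1]_x h x <= \int[m2]_x h x + e%:E.
Proof.
move=> m1T m2T e0 m12 [mh h0 h1 hh]; apply/lee_addgt0Pr => eta eta0.
have [n] := ltr_add_invr (y := 0%R) (x := eta) eta0; rewrite add0r => neta.
set k := n.+1 in neta; have k0 : (0 < k%:R :> R)%R by [].
pose I (j : nat) : set (borel S) := [set x | (j.+1%:R / k%:R)%:E <= h x].
have iI j : incr (I j).
  split; last by move=> x y xy /= /le_trans; apply; exact: hh.
  rewrite -[I j]setTI; exact: emeasurable_fun_c_infty.
pose hk x : \bar R := \sum_(j < k) ((k%:R^-1)%:E * (\1_(I j) x)%:E).
have hkE x : hk x = (k%:R^-1 * \sum_(j < k) (j.+1%:R <= k%:R * fine (h x))%R%:R)%:E.
  rewrite /hk mulr_sumr -sumEFin; apply: eq_bigr => j _.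
  rewrite EFinM indicE; congr (_ * _%:R%:E).
  congr nat_of_bool; apply/idP/idP.
    rewrite inE /I/= -(fineK (fin_num01 (h0 x) (h1 x))) lee_fin.
    by rewrite ler_pdivrMr// mulrC.
  move=> hj; rewrite inE /I/= -(fineK (fin_num01 (h0 x) (h1 x))) lee_fin.
  by rewrite ler_pdivrMr// mulrC.
have steps x : hk x <= h x /\ h x <= hk x + (k%:R^-1)%:E.
  rewrite hkE -(fineK (fin_num01 (h0 x) (h1 x))) -EFinD !lee_fin /=.
  have fh0 : (0 <= fine (h x))%R by exact: fine_ge0.
  have fh1 : (fine (h x) <= 1)%R by rewrite -lee_fin fineK// fin_num01.
  have [|c1 c2 _] := @count_steps R k (k%:R * fine (h x))%R.
    by rewrite mulr_ge0.
  have {}c2 := c2 _.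
  have kN0 : k%:R != 0%R :> R by rewrite gt_eqF.
  split; rewrite -(ler_pM2l k0) ?mulrDr mulrA divff// mul1r//.
  by apply: c2; rewrite ger_pMr.
have hk0 x : 0 <= hk x by apply: sume_ge0 => j _; rewrite mule_ge0// lee_fin.
have mI j : measurable_fun setT (fun x => (k%:R^-1)%:E * (\1_(I j) x)%:E).
  apply: measurable_funeM; apply/measurable_EFinP; apply: measurable_indic.
  by case: (iI j).
have mhk : measurable_fun setT hk by exact: emeasurable_sum.
have ihk (m : {measure set (borel S) -> \bar R}) :
    \int[m]_x hk x = \sum_(j < k) ((k%:R^-1)%:E * m (I j)).
  rewrite /hk ge0_integral_sum//.
  apply: eq_bigr => j _; rewrite ge0_integralZl//.
  - by rewrite integral_indic ?setIT//; case: (iI j).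
  - by apply/measurable_EFinP; apply: measurable_indic; case: (iI j).
apply: (@le_trans _ _ (\int[m1]_x (hk x + (k%:R^-1)%:E))).
  apply: ge0_le_integral => //.
  - by apply: emeasurable_funD => //; exact: measurable_cst.
  - by move=> x _; have [] := steps x.
rewrite ge0_integralD//.
rewrite integral_cst// m1T mule1 ihk.
apply: (@le_trans _ _
  (\sum_(j < k) ((k%:R^-1)%:E * m2 (I j)) + e%:E + eta%:E)); last first.
  rewrite -ihk leeD2r// leeD2r//; apply: ge0_le_integral => //.
  by move=> x _; have [] := steps x.
apply: leeD; last by rewrite lee_fin ltW.
have -> : e%:E = \sum_(j < k) ((k%:R^-1)%:E * e%:E).
  rewrite (eq_bigr (fun=> (k%:R^-1 * e)%:E))// sumEFin sumr_const card_ord.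
  rewrite -(mulr_natl (k%:R^-1 * e) k); congr EFin.
  by rewrite mulrA divff ?mul1r// gt_eqF.
rewrite -big_split/=; apply: lee_sum => j _; rewrite -ge0_muleDr ?lee_fin//.
by apply: lee_wpmul2l; [rewrite lee_fin|exact: m12].
Qed.

End staircase_integral.

Section crossing_limit.
Local Open Scope ereal_scope.
Context (R : realType) (d : Order.disp_t)
  (S : POrderedPointedTopological.type d) (P : R.-pker borel S ~> borel S).
Hypothesis hinc : increasing_kernel P.
Hypothesis mM : measurable (@not_le d S).
Hypothesis mitv : forall a b : S, measurable (order_itv a b : set (borel S)).
Hypothesis htight : forall (x y : S) (e : R), (0 < e)%R ->
  exists a b : S, (a <= b)%O /\ forall t,
    kernel_pow P t x (~` order_itv a b) <= e%:E /\
    kernel_pow P t y (~` order_itv a b) <= e%:E.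
Hypothesis hrev : forall a b : S, (a <= b)%O ->
  exists s, pair_op (kernel_pow P s) (@not_le_indic R d S) (b, a) < 1.

(** The sequence decreases, and its limit l satisfies
    l <= (1 - delta) l + delta e, hence l <= e.  The constant delta depends on
    e through the box, but it cancels. *)
Lemma not_crossed_cvg0 z : not_crossed P t z @[t --> \oo] --> 0.
Proof.
have nc01 t : 0 <= not_crossed P t z <= 1.
  by have [_ q0 q1 _] := mono01_not_crossed hinc mM t; rewrite q0 q1.
have ncf t : not_crossed P t z \is a fin_num.
  by have /andP[? ?] := nc01 t; exact: fin_num01.
pose r t := fine (not_crossed P t z).
have ncE t : not_crossed P t z = (r t)%:E by rewrite /r fineK.
have r0 t : (0 <= r t)%R by apply: fine_ge0; have /andP[] := nc01 t.
have rS t : (r t.+1 <= r t)%R.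
  by rewrite -lee_fin -!ncE; exact: not_crossed_leS.
have rcvg : cvgn r.
  apply: nonincreasing_is_cvgn; first exact/nonincreasing_seqP.
  by exists 0%R => _ [t _ <-].
suff l0 : limn r = 0%R.
  have -> : (fun t => not_crossed P t z) = EFin \o r.
    by apply/funext => t; exact: ncE.
  by apply/fine_cvgP; split; [by apply: nearW|rewrite -l0; exact: rcvg].
apply/eqP; rewrite eq_le; apply/andP; split; last first.
  by apply: limr_ge => //; apply: nearW.
apply/ler_addgt0Pr => e e0; rewrite add0r.
have e20 : (0 < e / 2)%R by rewrite divr_gt0.
have [a [b [ab hab]]] := htight z.1 z.2 e20.
have [s hs] := hrev ab.
have [_ p0 p1 _] := mono01_pair_op_pow hinc s (mono01_not_le_indic R mM).
set p := pair_op _ _ _ in hs.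
have pf : p \is a fin_num by exact: (fin_num01 (p0 _) (p1 _)).
pose delta := (1 - fine p)%R.
have fp0 : (0 <= fine p)%R by apply: fine_ge0; exact: p0.
have fp1 : (fine p < 1)%R by rewrite -lte_fin fineK.
have d0 : (0 < delta)%R by rewrite subr_gt0.
have d1 : (delta <= 1)%R by rewrite lerBlDr lerDl.
have hd : p <= (1 - delta)%:E by rewrite /delta subKr fineK.
have step t : (r (t + s)%N <= (1 - delta) * r t + delta * e)%R.
  have d01 : (0 < delta <= 1)%R by rewrite d0 d1.
  have := not_crossed_contraction hinc mM (mitv a b) d01 hd t z.
  rewrite !ncE => /le_trans h; rewrite -lee_fin; apply: h.
  rewrite [leRHS]EFinD [X in _ <= X + _]EFinM [X in _ <= _ + X]EFinM.
  apply: leeD => //.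
  apply: lee_wpmul2l; first by rewrite lee_fin ltW.
  rewrite [e in leRHS](splitr e) EFinD.
  by have [h1 h2] := hab t; exact: leeD.
have h1 : r (n + s)%N @[n --> \oo] --> limn r by rewrite cvg_shiftn.
have h2 : ((1 - delta) * r t + delta * e)%R @[t --> \oo] -->
    ((1 - delta) * limn r + delta * e)%R.
  apply: cvgD; last exact: cvg_cst.
  by apply: cvgM => //; exact: cvg_cst.
have H : (limn r <= (1 - delta) * limn r + delta * e)%R.
  by apply: (ler_cvg_to h1 h2); apply: nearW.
by rewrite -(ler_pM2l d0); move: H; rewrite mulrBl mul1r; lra.
Qed.

(** Conditioning on the position y at time m compares the law at time m + N with
    the law at time N, by the coupling bound for y and x0.  For y in [a, b]
    the error is at most its value at b, or at a; tightness takes care of the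
    other y.  Neither estimate depends on m or on the increasing set. *)
Lemma kernel_pow_cauchy (x0 : S) (e : R) : (0 < e)%R ->
  exists N, forall n, (N <= n)%N ->
    incr_close e (kernel_pow P n x0) (kernel_pow P N x0).
Proof.
move=> e0; have e20 : (0 < e / 2)%R by rewrite divr_gt0.
have [a [b [ab hab]]] := htight x0 x0 e20.
have small z : exists N, forall n, (N <= n)%N -> not_crossed P n z <= (e / 2)%:E.
  have /fine_cvgP[[M _ hM] /cvgrPdist_le/(_ _ e20)[N _ hN]] := not_crossed_cvg0 z.
  exists (maxn M N) => n; rewrite geq_max => /andP[/hM nf /hN] /=.
  rewrite sub0r normrN -lee_fin => h; rewrite -(fineK nf); apply: le_trans h.
  by rewrite lee_fin ler_norm.
have [N1 hN1] := small (b, x0); have [N2 hN2] := small (x0, a).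
pose N := maxn N1 N2.
have q1 := hN1 N (leq_maxl _ _); have q2 := hN2 N (leq_maxr _ _).
exists N => n Nn; rewrite -(subnK Nn); move: (n - N)%N => m I iI {n Nn}.
have iI1 := incr01_indic R iI; have [mI i0 i1 hi] := iI1.
have mI' : measurable I by case: iI.
have powE n x : \int[kernel_pow P n x]_y (\1_I y)%:E = kernel_pow P n x I.
  by rewrite integral_indic ?setIT.
have [mh h0 h1 hh] := incr01_kernel_pow hinc N iI1.
have kT : kernel_pow P m x0 setT = 1 by exact: prob_kernel.
have D : kernel_pow P (m + N) x0 I = \int[kernel_pow P m x0]_y kernel_pow P N y I.
  rewrite -powE integral_kernel_powD//.
  by apply: eq_integral => y _; rewrite powE.
have mJ : measurable (~` order_itv a b : set (borel S)) by exact: measurableC.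
pose out (x : borel S) : \bar R := (\1_(~` order_itv a b) x)%:E.
have mout : measurable_fun setT out.
  by apply/measurable_EFinP; exact: measurable_indic.
have out0 x : 0 <= out x by rewrite lee_fin.
have iout : \int[kernel_pow P m x0]_y out y <= (e / 2)%:E.
  by rewrite integral_indic// setIT; have [] := hab m.
have outP y : order_itv a b y \/ out y = 1.
  have [?|n] := pselect (order_itv a b y); first by left.
  by right; rewrite /out indicE mem_set.
have [mN n0 n1 hn] := mono01_not_crossed hinc mM N.
have bound1 y : not_crossed P N (y, x0) <= (e / 2)%:E + out y.
  have [/andP[ay yb]|->] := outP y.
    apply: (@le_trans _ _ (e / 2)%:E); last by rewrite leeDl.
    by apply: le_trans q1; exact: hn.
  by apply: (le_trans (n1 _)); rewrite leeDr// lee_fin ltW.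
have bound2 y : not_crossed P N (x0, y) <= (e / 2)%:E + out y.
  have [/andP[ay yb]|->] := outP y.
    apply: (@le_trans _ _ (e / 2)%:E); last by rewrite leeDl.
    by apply: le_trans q2; exact: hn.
  by apply: (le_trans (n1 _)); rewrite leeDr// lee_fin ltW.
have mPN : measurable_fun setT (fun y => kernel_pow P N y I).
  exact: measurable_kernel.
have PN0 y : 0 <= kernel_pow P N y I by [].
have e2c : 0 <= (e / 2)%:E :> \bar R by rewrite lee_fin ltW.
have mc (c : \bar R) : measurable_fun setT (fun y : borel S => c + out y).
  by apply: emeasurable_funD => //; exact: measurable_cst.
have mco (c : \bar R) :
    measurable_fun setT (fun y : borel S => c + ((e / 2)%:E + out y)).
  by apply: emeasurable_funD => //; exact: measurable_cst.
have int_c : \int[kernel_pow P m x0]_y ((e / 2)%:E + out y) <= e%:E.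
  rewrite ge0_integralD// integral_cst// kT mule1 [e in leRHS](splitr e) EFinD.
  exact: leeD.
rewrite D; split.
- apply: (@le_trans _ _ (\int[kernel_pow P m x0]_y
      (kernel_pow P N x0 I + ((e / 2)%:E + out y)))).
    apply: ge0_le_integral => // y _.
    have := coupling hinc mM N (y, x0) iI1; rewrite /= !powE => /le_trans; apply.
    exact: leeD2l.
  rewrite ge0_integralD//; last by move=> y _; exact: adde_ge0.
  by rewrite integral_cst// kT mule1; exact: leeD2l.
- apply: (@le_trans _ _ (\int[kernel_pow P m x0]_y
      (kernel_pow P N y I + ((e / 2)%:E + out y)))).
    rewrite -[leLHS]mule1 -kT -integral_cst//.
    apply: ge0_le_integral => //.
      by apply: emeasurable_funD.
    move=> y _.
    have := coupling hinc mM N (x0, y) iI1; rewrite /= !powE => /le_trans; apply.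
    exact: leeD2l.
  rewrite ge0_integralD//; first exact: leeD2l.
  by move=> y _; exact: adde_ge0.
Qed.

End crossing_limit.

(** * Laws of Markov processes and order reversing kernels *)

Section markov_law.
Local Open Scope ereal_scope.
Context (R : realType) (dO dT : measure_display) (Om : measurableType dO)
  (T : measurableType dT) (P : R.-pker T ~> T).

(** The Markov property, integrated over the whole space, appends a last step to
    the law, while [kernel_pow] prepends a first one; the semigroup property
    reconciles the two. *)
Lemma markov_law (Pr : probability Om R) (X : nat -> Om -> T) (x : T) :
  markov_process P Pr X -> measurable [set x] -> Pr (X 0%N @^-1` [set x]) = 1 ->
  forall t B, measurable B -> Pr (X t @^-1` B) = kernel_pow P t x B.
Proof.
move=> [mX hX] mx X0; elim=> [|t IH] B mB.
  have mXB : measurable (X 0%N @^-1` B).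
    by rewrite -[X in measurable X]setTI; exact: mX.
  have mXx : measurable (X 0%N @^-1` [set x]).
    by rewrite -[X in measurable X]setTI; exact: mX.
  have X0C : Pr (~` (X 0%N @^-1` [set x])) = 0.
    by rewrite probability_setC// X0 subee.
  rewrite (measure_setC0 mXB mXx X0C) /= /kdirac diracE.
  have [/set_mem Bx|/negP nBx] := boolP (x \in B).
    rewrite (_ : _ `&` _ = X 0%N @^-1` [set x])//.
    by apply/seteqP; split => w /=; [case|move=> ->].
  rewrite (_ : _ `&` _ = set0) ?measure0//.
  by apply/seteqP; split => w //= [+ wx]; rewrite wx => /mem_set.
have nT : natural_filtration X t setT.
  exact: (@measurableT _ (g_sigma_algebraType
    (\bigcup_(s in [set s | (s <= t)%N])
      preimage_set_system setT (X s) measurable))).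
have := hX t setT B nT mB; rewrite setTI => ->.
have mP : measurable_fun setT (fun y => P y B) by exact: measurable_kernel.
transitivity (\int[kernel_pow P t x]_y P y B).
  rewrite -(@eq_measure_integral _ _ _ setT _ (pushforward Pr (X t))); last first.
    by move=> A mA _; exact: IH.
  by rewrite ge0_integral_pushforward// preimage_setT.
have E y : P y B = \int[kernel_pow P 1 y]_z (\1_B z)%:E.
  rewrite integral_kernel_powS//; last first.
    by apply/measurable_EFinP; exact: measurable_indic.
  under eq_integral do rewrite integral_kernel_pow0 ?(measurable_EFinP _ _)//.
  by rewrite integral_indic ?setIT.
under eq_integral do rewrite E.
rewrite -integral_kernel_powD//; last first.
  by apply/measurable_EFinP; exact: measurable_indic.
by rewrite integral_indic ?setIT// addn1.
Qed.

(** By independence the joint law at time t and the product of the marginals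
    agree on rectangles. *)
Lemma independent_markov_law (Pr : probability Om R) (X X' : nat -> Om -> T)
    (x x' : T) (A : set (T * T)) t :
  independent_markov P Pr X X' -> measurable [set x] -> measurable [set x'] ->
  Pr (X 0%N @^-1` [set x]) = 1 -> Pr (X' 0%N @^-1` [set x']) = 1 ->
  measurable A ->
  Pr ((fun w => (X t w, X' t w)) @^-1` A) =
    pair_op (kernel_pow P t) (fun z => (\1_A z)%:E) (x, x').
Proof.
move=> [hX hX' ind] mx mx' X0 X0' mA.
have k1 y : kernel_pow P t y setT = 1 by exact: prob_kernel.
have [p1 p1E] := probability_of_measure (k1 x).
have [p2 p2E] := probability_of_measure (k1 x').
have mA1 : measurable_fun setT (fun z : T * T => (\1_A z)%:E : \bar R).
  by apply/measurable_EFinP; exact: measurable_indic.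
have E1 (h : T -> \bar R) : \int[kernel_pow P t x]_y h y = \int[p1]_y h y.
  by apply: eq_measure_integral => B _ _; rewrite -p1E.
have E2 (h : T -> \bar R) : \int[kernel_pow P t x']_y h y = \int[p2]_y h y.
  by apply: eq_measure_integral => B _ _; rewrite -p2E.
rewrite /pair_op E1; under eq_integral do rewrite E2.
rewrite -(fubini_tonelli1 (fun z => (\1_A z)%:E))//.
rewrite integral_indic// setIT.
have mXX : measurable_fun setT (fun w => (X t w, X' t w)).
  by apply: measurable_fun_pair; [case: hX|case: hX'].
apply/esym.
pose law :=
  measure_function_pushforward__canonical__measure_function_Measure Pr mXX.
apply: (product_measure_unique (m' := law)) => //.
move=> B C mB mC /=; rewrite /pushforward.
rewrite (_ : _ @^-1` _ = X t @^-1` B `&` X' t @^-1` C)//.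
rewrite ind.
- by rewrite (markov_law hX mx X0)// (markov_law hX' mx' X0')// p1E p2E.
- apply: sub_sigma_algebra; exists t => //; exists B => //; by rewrite setTI.
- apply: sub_sigma_algebra; exists t => //; exists C => //; by rewrite setTI.
Qed.

End markov_law.

Section order_reversing_kernel.
Local Open Scope ereal_scope.
Context (R : realType) (d : Order.disp_t)
  (S : POrderedPointedTopological.type d) (P : R.-pker borel S ~> borel S).
Hypothesis mM : measurable (@not_le d S).
Hypothesis m1 : forall x : S, measurable ([set x] : set (borel S)).

(** Order reversing speaks of pairs whose first point is the larger one, hence
    of (b, a). *)
Lemma order_reversing_pair_op : order_reversing P -> forall a b : S, (a <= b)%O ->
  exists s, pair_op (kernel_pow P s) (@not_le_indic R d S) (b, a) < 1.
Proof.
move=> [dO [Om [Pr [X [X' [Q [_ _ hQ hrev]]]]]]] a b ab.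
have [ind X0 X0'] := hQ b a; have [t ht] := hrev b a ab; exists t.
have := independent_markov_law t ind (m1 b) (m1 a) X0 X0' mM.
rewrite /not_le_indic => <-.
have [[mX _] [mX' _] _] := ind.
have mXX : measurable_fun setT (fun w => (X t w, X' t w)).
  by apply: measurable_fun_pair.
set N := _ @^-1` _.
have mN : measurable N.
  by rewrite -[N]setTI; exact: mXX.
have -> : N = ~` [set w | ((X t w : S) <= (X' t w : S))%O] by [].
have mle : measurable [set w | ((X t w : S) <= (X' t w : S))%O].
  rewrite (_ : [set w | _] = ~` N); first exact: measurableC.
  by rewrite /N; apply/seteqP; split => w /=; [move=> h; exact|move/contrapT].
rewrite probability_setC//.
have qf : Q (b, a) [set w | ((X t w : S) <= (X' t w : S))%O] \is a fin_num.
  by apply: fin_num01 => //; exact: probability_le1.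
move: ht; rewrite -(fineK qf) lte_fin => ht.
by rewrite -EFinB lte_fin ltrBlDr ltrDl.
Qed.

End order_reversing_kernel.

(** * The distance beta *)

Section beta_metric.
Local Open Scope ereal_scope.
Context (R : realType) (d : Order.disp_t)
  (S : POrderedPointedTopological.type d).
Implicit Types m : {measure set (borel S) -> \bar R}.

(** Rescales [-1, 1] to [0, 1], where the coupling bound applies. *)
Lemma ibS_incr01 (h : borel S -> R) : ibS h -> (forall x, `|h x| <= 1)%R ->
  incr01 (fun x => ((h x + 1) / 2)%:E).
Proof.
move=> [mh _ hh] h1; have hb x : (- 1 <= h x <= 1)%R by rewrite -ler_norml.
split.
- apply/measurable_EFinP; apply: measurable_funM => //.
  by apply: measurable_funD => //.
- by move=> x; rewrite lee_fin; have := hb x; lra.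
- by move=> x; rewrite lee_fin; have := hb x; lra.
- by move=> x y /hh; rewrite lee_fin; lra.
Qed.

Lemma Rintegral_ibS m (h : borel S -> R) : m setT = 1 -> ibS h ->
  (forall x, `|h x| <= 1)%R ->
  (\int[m]_x h x)%R = (2 * fine (\int[m]_x ((h x + 1) / 2)%:E) - 1)%R.
Proof.
move=> m1 ih h1; have [mg g0 g1 _] := ibS_incr01 ih h1.
have [mh [M hM] _] := ih.
have inth : m.-integrable setT (EFin \o h).
  apply: measurable_bounded_integrable => //.
    by rewrite m1 ltry.
  exists 1%R; split => // r r1 x _ /=; apply: le_trans (h1 x) _; exact: ltW.
have E : \int[m]_x ((h x + 1) / 2)%:E = (2^-1)%:E * (\int[m]_x (h x)%:E + 1).
  transitivity (\int[m]_x ((2^-1)%:E * ((h x)%:E + 1))).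
    by apply: eq_integral => x _; rewrite -EFinD -EFinM mulrC.
  have int1 : m.-integrable setT (cst 1).
    apply/integrableP; split => //; under eq_integral do rewrite abse1.
    by rewrite integral_cst// m1 mule1 ltry.
  rewrite integralZl//; last exact: integrableD.
  by rewrite integralD// integral_cst// m1 mul1e.
rewrite E /Rintegral.
have /fineK <- : \int[m]_x (h x)%:E \is a fin_num by exact: integrable_fin_num.
rewrite -EFinD -EFinM /=; lra.
Qed.

Let beta_elem m1 m2 (e : R) (h : borel S -> R) : m1 setT = 1 -> m2 setT = 1 ->
  (forall g, incr01 g -> \int[m1]_x g x <= \int[m2]_x g x + e%:E /\
    \int[m2]_x g x <= \int[m1]_x g x + e%:E) ->
  ibS h -> (forall x, `|h x| <= 1)%R ->
  (`|\int[m1]_x h x - \int[m2]_x h x| <= 2 * e)%R.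
Proof.
move=> m1T m2T m12 ih h1; rewrite !Rintegral_ibS//.
have ig := ibS_incr01 ih h1; have [mg g0 g1 _] := ig.
have gf m : m setT = 1 -> \int[m]_x ((h x + 1) / 2)%:E \is a fin_num.
  by move=> mT; apply: fin_num01; [exact: integral_ge0|exact: integral_le1].
have [] := m12 _ ig; rewrite -(fineK (gf _ m1T)) -(fineK (gf _ m2T)).
rewrite -!EFinD !lee_fin /=; move: (fine _) (fine _) => u v uv vu.
by rewrite ler_norml; lra.
Qed.

Let beta_ubound m1 m2 : m1 setT = 1 -> m2 setT = 1 ->
  has_ubound [set `|\int[m1]_x h x - \int[m2]_x h x|%R
      | h in [set h : borel S -> R | ibS h /\ forall x, (`|h x| <= 1)%R]].
Proof.
move=> m1T m2T; exists (2 * 1)%R => _ [h [ih h1] <-].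
apply: beta_elem => // g [mg g0 g1 _]; split.
  apply: (le_trans (integral_le1 m1T mg g0 g1)).
  by rewrite leeDr//; exact: integral_ge0.
apply: (le_trans (integral_le1 m2T mg g0 g1)).
by rewrite leeDr//; exact: integral_ge0.
Qed.

(** The factor 2 undoes the rescaling of the test functions. *)
Lemma beta_bounds m1 m2 (e : R) : m1 setT = 1 -> m2 setT = 1 ->
  (forall g, incr01 g -> \int[m1]_x g x <= \int[m2]_x g x + e%:E /\
    \int[m2]_x g x <= \int[m1]_x g x + e%:E) ->
  (0 <= beta m1 m2 <= 2 * e)%R.
Proof.
move=> m1T m2T m12.
have i0 : ibS (cst 0%R : borel S -> R) /\
    forall x : borel S, (`|cst 0 x| <= 1 :> R)%R.
  split; last by move=> x; rewrite normr0.
  split; [exact: measurable_cst|exists 0%R => x; rewrite normr0//|by []].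
apply/andP; split.
  apply: (@le_trans _ _ `|\int[m1]_x (cst 0 x) - \int[m2]_x (cst 0 x)|%R) => //.
  apply: ub_le_sup; first exact: beta_ubound.
  by exists (cst 0%R).
apply: ge_sup.
  by exists `|\int[m1]_x (cst 0 x) - \int[m2]_x (cst 0 x)|%R, (cst 0%R).
by move=> _ [h [ih h1] <-]; exact: beta_elem.
Qed.

Lemma beta_indic m1 m2 I : m1 setT = 1 -> m2 setT = 1 -> incr I ->
  m1 I <= m2 I + (beta m1 m2)%:E /\ m2 I <= m1 I + (beta m1 m2)%:E.
Proof.
move=> m1T m2T iI; have [mI uI] := iI.
have mf m : m setT = 1 -> m I \is a fin_num.
  move=> mT; rewrite ge0_fin_numE//.
  by apply: measure_lt_pinfty => //; rewrite mT ltry.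
have [_ _ i1 i2] := incr01_indic R iI.
have : (`|fine (m1 I) - fine (m2 I)| <= beta m1 m2)%R.
  apply: ub_le_sup; first exact: beta_ubound.
  exists (\1_I).
    split; last by move=> x; rewrite ger0_norm// -lee_fin; exact: i1.
    split; first exact: measurable_indic.
      by exists 1%R => x; rewrite ger0_norm// -lee_fin; exact: i1.
    by move=> x y xy; rewrite -lee_fin; exact: i2.
  by rewrite /Rintegral !integral_indic// !setIT.
rewrite -(fineK (mf _ m1T)) -(fineK (mf _ m2T)) -!EFinD !lee_fin /=.
by rewrite ler_norml; lra.
Qed.

End beta_metric.

(** * Global stability *)

Lemma integral_cst1 d (T : measurableType d) (R : realType)
    (m : {measure set T -> \bar R}) (r : \bar R) :
  (m setT = 1 -> \int[m]_x r = r)%E.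
Proof. by move=> mT; rewrite integral_cst// mT mule1. Qed.

Section convergence.
Local Open Scope ereal_scope.
Context (R : realType) (d : Order.disp_t)
  (S : POrderedPointedTopological.type d) (P : R.-pker borel S ~> borel S).

Lemma kernel_act_pow (phi : probability (borel S) R) t :
  kernel_act phi P ≡μ phi ->
  kernel_act phi (kernel_pow P t) ≡μ phi.
Proof.
move=> st B mB.
have mB1 : measurable_fun setT (fun x : borel S => (\1_B x)%:E : \bar R).
  by apply/measurable_EFinP; exact: measurable_indic.
have B0 (x : borel S) : 0 <= (\1_B x)%:E :> \bar R by rewrite lee_fin.
have E k : kernel_act phi (kernel_pow P k) B =
    \int[phi]_x \int[kernel_pow P k x]_y (\1_B y)%:E.
  by rewrite -integral_kernel_act// integral_indic ?setIT.
suff F : \int[phi]_x \int[kernel_pow P t x]_y (\1_B y)%:E = phi B.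
  by transitivity (\int[phi]_x \int[kernel_pow P t x]_y (\1_B y)%:E); [exact: E|].
elim: t => [|t IH].
  under eq_integral do rewrite integral_kernel_pow0//.
  by rewrite integral_indic ?setIT.
under eq_integral do rewrite integral_kernel_powS//.
rewrite -integral_kernel_act.
- by rewrite (eq_measure_integral phi)//; move=> A mA _; exact: st.
- by move=> x; exact: integral_ge0.
- exact: measurable_integral_kernel_pow.
Qed.

Hypothesis hinc : increasing_kernel P.
Hypothesis mM : measurable (@not_le d S).
Implicit Types phi psi : probability (borel S) R.

Let prod1 phi psi : (phi \x psi) setT = 1.
Proof.
rewrite -setXTT product_measure1E// -[RHS]mule1.
by congr (_ * _); exact: probability_setT.
Qed.

Lemma coupling_integral phi psi t g : incr01 g ->
  \int[kernel_act psi (kernel_pow P t)]_x g x <=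
  \int[kernel_act phi (kernel_pow P t)]_x g x +
    \int[psi \x phi]_z not_crossed P t z.
Proof.
move=> ig; have [mg g0 g1 _] := ig.
rewrite !integral_kernel_act//.
have [mh h0 h1 hh] := incr01_kernel_pow hinc t ig.
set h := fun x => _ in mh h0 h1 hh.
have mh1 : measurable_fun setT (fun z : borel S * borel S => h z.1).
  exact: (measurableT_comp mh (@measurable_fst _ _ _ _)).
have mh2 : measurable_fun setT (fun z : borel S * borel S => h z.2).
  exact: (measurableT_comp mh (@measurable_snd _ _ _ _)).
have -> : \int[psi]_y \int[kernel_pow P t y]_z g z = \int[psi \x phi]_z h z.1.
  rewrite fubini_tonelli1//; last by move=> z; exact: h0.
  apply: eq_integral => x _; rewrite /fubini_F/= integral_cst1//.
  exact: probability_setT.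
have -> : \int[phi]_y \int[kernel_pow P t y]_z g z = \int[psi \x phi]_z h z.2.
  rewrite fubini_tonelli1//; last by move=> z; exact: h0.
  by rewrite /fubini_F/= integral_cst1//; exact: probability_setT.
have [mq q0 q1 _] := mono01_not_crossed hinc mM t.
have hz1 z : 0 <= h z.1 by exact: h0.
have hz2 z : 0 <= h z.2 by exact: h0.
rewrite -ge0_integralD//; apply: ge0_le_integral => //.
- exact: emeasurable_funD.
- by move=> z _; exact: coupling.
Qed.

Lemma not_crossed_integral_cvg0 phi psi :
  (forall z, not_crossed P t z @[t --> \oo] --> 0) ->
  \int[psi \x phi]_z not_crossed P t z @[t --> \oo] --> 0.
Proof.
move=> q0; have := @dominated_convergence _ _ R (psi \x phi) setT measurableT
  (not_crossed P) (cst 0) (cst 1).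
case => //.
- by move=> n; have [] := mono01_not_crossed hinc mM n.
- by apply: aeW => z _; exact: q0.
- apply/integrableP; split => //; under eq_integral do rewrite abse1.
  by rewrite integral_cst1 ?ltry//; exact: prod1.
- apply: aeW => z n _; have [_ n0 n1 _] := mono01_not_crossed hinc mM n.
  by rewrite gee0_abs.
- by move=> _ _; rewrite integral0.
Qed.

(** A chain started from the invariant law keeps it.  Coupling with this chain,
    in both directions, bounds beta by integrals that do not involve the test
    function and vanish by dominated convergence. *)
Lemma beta_cvg0 phi psi : kernel_act phi P ≡μ phi ->
  (forall z, not_crossed P t z @[t --> \oo] --> 0) ->
  beta (kernel_act psi (kernel_pow P t)) phi @[t --> \oo] --> (0 : R)%R.
Proof.
move=> st q0.
pose A t := \int[psi \x phi]_z not_crossed P t z.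
pose B t := \int[phi \x psi]_z not_crossed P t z.
have A0 : A t @[t --> \oo] --> 0 by exact: not_crossed_integral_cvg0.
have B0 : B t @[t --> \oo] --> 0 by exact: not_crossed_integral_cvg0.
have AB01 (m1 m2 : probability (borel S) R) t :
    0 <= \int[m1 \x m2]_z not_crossed P t z /\
    \int[m1 \x m2]_z not_crossed P t z <= 1.
  have [mq n0 n1 _] := mono01_not_crossed hinc mM t.
  by split; [exact: integral_ge0|apply: integral_le1 => //; exact: prod1].
have Af t : A t \is a fin_num by have [? ?] := AB01 psi phi t; exact: fin_num01.
have Bf t : B t \is a fin_num by have [? ?] := AB01 phi psi t; exact: fin_num01.
have bd t : (0 <= beta (kernel_act psi (kernel_pow P t)) phi <=
    2 * (fine (A t) + fine (B t)))%R.
  apply: beta_bounds; [exact: probability_setT|exact: probability_setT|].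
  move=> g ig.
  have E : \int[kernel_act phi (kernel_pow P t)]_x g x = \int[phi]_x g x.
    by apply: eq_measure_integral => C mC _; exact: kernel_act_pow.
  have A0' : 0 <= A t by have [] := AB01 psi phi t.
  have B0' : 0 <= B t by have [] := AB01 phi psi t.
  rewrite EFinD !fineK// -!E; split.
    by apply: (le_trans (coupling_integral phi psi t ig)); rewrite leeD2l// leeDl.
  by apply: (le_trans (coupling_integral psi phi t ig)); rewrite leeD2l// leeDr.
apply: (@squeeze_cvgr _ _ _ _ (cst 0%R) (fun t => 2 * (fine (A t) + fine (B t)))%R).
- by apply: nearW => t; exact: bd.
- exact: cvg_cst.
- rewrite [X in _ --> X](_ : _ = 2 * (0 + 0))%R; last by rewrite addr0 mulr0.
  apply: cvgM; first exact: cvg_cst.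
  by apply: cvgD; apply: fine_cvg.
Qed.

End convergence.

Section stability.
Local Open Scope ereal_scope.
Context (R : realType) (d : Order.disp_t)
    (S : POrderedPointedTopological.type d).
Hypothesis hle : closed_rel (@le_rel d S).
Hypothesis hcompact : forall A : set S, compact A <-> closed A /\ order_bounded A.
Context (dist : S -> S -> R).
Hypothesis hd : complete_metric dist.
Hypothesis hS : separable S.
Context (P : R.-pker borel S ~> borel S).
Hypothesis hinc : increasing_kernel P.

Lemma measure_setC_close (m1 m2 : {measure set (borel S) -> \bar R})
    (A : set (borel S)) (e : R) :
  m1 setT = 1 -> m2 setT = 1 -> measurable A -> m2 A <= m1 A + e%:E ->
  m1 (~` A) <= m2 (~` A) + e%:E.
Proof.
move=> m1T m2T mA.
have mf (m : {measure set (borel S) -> \bar R}) : m setT = 1 -> m A \is a fin_num.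
  move=> mT; rewrite ge0_fin_numE//.
  by apply: measure_lt_pinfty => //; rewrite mT ltry.
have mC (m : {measure set (borel S) -> \bar R}) : m setT = 1 -> m (~` A) = 1 - m A.
  move=> mT; rewrite -setTD measureD//; last first.
    by apply: measure_lt_pinfty => //; rewrite mT ltry.
  by rewrite setTI; congr (_ - _).
rewrite !mC//.
move: (mf m1 m1T) (mf m2 m2T) => /fineK <- /fineK <-.
rewrite -!EFinB -!EFinD !lee_fin; lra.
Qed.

(** The complement of [a, b] is the union of the complement of the increasing
    set above a and that of the decreasing set below b; on each of them beta
    bounds the deviation from the invariant law.  Ulam's theorem handles the
    finitely many times at which beta is not yet small. *)
Lemma globally_stable_bounded : globally_stable P -> bounded_in_probability P.
Proof.
move=> [phi [[_ hb] _]] x e e0.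
have e40 : (0 < e / 4)%R by rewrite divr_gt0.
have phiT : phi setT = 1 by exact: probability_setT.
have philt : phi setT < +oo by rewrite phiT ltry.
have kT t : kernel_pow P t x setT = 1 by exact: prob_kernel.
have [a [b [ab phiab _]]] := ulam_order_itv2 hle hcompact hd hS philt philt e40.
pose dx : probability (borel S) R := \d_(x : borel S).
have [N _ hN] : \forall t \near \oo,
    (beta (kernel_act dx (kernel_pow P t)) phi <= e / 4)%R.
  by apply: cvgr_le e40; exact: hb.
have actE t B : measurable B ->
    kernel_act dx (kernel_pow P t) B = kernel_pow P t x B.
  move=> mB; rewrite /kernel_act/= integral_dirac//; last exact: measurable_kernel.
  by rewrite diracT mul1e.
have clK (K : set S) : compact K -> closed K by move=> /hcompact[].
have mitv : measurable (order_itv a b : set (borel S)) by exact: borel_order_itv.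
have tail t : (N <= t)%N -> kernel_pow P t x (~` order_itv a b) <= e%:E.
  move=> Nt.
  have [iU mU] : incr (upclosure (@le_rel d S) [set a]) /\
      measurable (upclosure (@le_rel d S) [set a] : set (borel S)).
    have i : incr (upclosure (@le_rel d S) [set a]).
      exact/incr_upclosure/compact_set1.
    by split => //; case: i.
  have [iD mD] : decr (upclosure (@ge_rel d S) [set b]) /\
      measurable (upclosure (@ge_rel d S) [set b] : set (borel S)).
    have i : decr (upclosure (@ge_rel d S) [set b]).
      exact/decr_upclosure/compact_set1.
    by split => //; case: i.
  set U := upclosure _ [set a] in iU mU; set D := upclosure _ [set b] in iD mD.
  have actT : kernel_act dx (kernel_pow P t) setT = 1 by rewrite actE.
  have bt : (beta (kernel_act dx (kernel_pow P t)) phi)%:E <= (e / 4)%:E.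
    by rewrite lee_fin; exact: hN.
  have phi_small (A : set (borel S)) : measurable A ->
      A `<=` ~` order_itv a b -> phi A <= (e / 4)%:E.
    move=> mA AI; apply: le_trans phiab; apply: le_measure; rewrite ?inE//.
    exact: measurableC.
  have hU : kernel_pow P t x (~` U) <= (e / 4)%:E + (e / 4)%:E.
    rewrite -actE; last exact: measurableC.
    have [_ h] := beta_indic actT phiT iU.
    apply: (le_trans (measure_setC_close actT phiT mU h)); apply: leeD => //.
    apply: phi_small; first exact: measurableC.
    by apply: subsetC => z /andP[az _]; exists a.
  have hD : kernel_pow P t x (~` D) <= (e / 4)%:E + (e / 4)%:E.
    rewrite -actE; last exact: measurableC.
    have [h _] := beta_indic actT phiT (decrC iD).
    apply: (le_trans h); apply: leeD => //.
    apply: phi_small; first exact: measurableC.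
    by apply: subsetC => z /andP[_ zb]; exists b.
  (* each complement costs e / 4 for the invariant law and e / 4 for beta *)
  have -> : e%:E = (e / 4)%:E + (e / 4)%:E + ((e / 4)%:E + (e / 4)%:E).
    by rewrite -!EFinD; congr EFin; lra.
  apply: le_trans (leeD hU hD).
  have mUC : measurable (~` U : set (borel S)) by exact: measurableC.
  have mDC : measurable (~` D : set (borel S)) by exact: measurableC.
  apply: le_trans (measureU2 _ mUC mDC); apply: le_measure; rewrite ?inE.
  - exact: measurableC.
  - exact: measurableU.
  - move=> z nz; have [[_ -> az]|] := pselect (U z); last by left.
    by right => -[_ -> zb]; apply: nz; apply/andP.
have /choice[K KP] (t : nat) : exists K : set S, [/\ compact K, closed K &
    kernel_pow P t x (~` K) <= e%:E].
  by apply: (ulam_tight hd hS) => //; rewrite kT ltry.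
pose K0 := order_itv a b `|` \big[setU/set0]_(t < N) K t.
have cK0 : compact K0.
  apply: compactU; first exact: compact_order_itv.
  by apply: bigsetU_compact => t _; have [] := KP t.
have mK0 : measurable (~` K0 : set (borel S)).
  by apply: measurableC; apply: closed_borel; exact: clK.
exists K0; split => // t; have [Nt|tN] := leqP N t.
  apply: le_trans (tail t Nt); apply: le_measure; rewrite ?inE//.
    exact: measurableC.
  by apply: subsetC => z; left.
have [_ cK hK] := KP t; apply: le_trans hK; apply: le_measure; rewrite ?inE//.
  by apply: measurableC; exact: closed_borel.
apply: subsetC => z Kz; right; rewrite -bigcup_mkord; by exists t.
Qed.

(** Invariance of the limit need only be checked on an increasing set I.  There
    x |-> P x I is increasing as well, so both sides are limits of the mass
    that the chain started at a fixed point gives to I. *)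
Lemma bounded_globally_stable : order_reversing P ->
  bounded_in_probability P -> globally_stable P.
Proof.
move=> hrev hbip.
have mM : measurable (@not_le d S) by exact: measurable_not_le hd hS hle.
have m1 (x : S) : measurable ([set x] : set (borel S)).
  apply: closed_borel.
  rewrite (_ : [set x] = order_itv x x); first exact: closed_order_itv.
  apply/seteqP; split => y; first by move=> ->; rewrite /order_itv/= lexx.
  by rewrite /order_itv/= => yx; apply/eqP; rewrite eq_le andbC.
have mitv (a b : S) : measurable (order_itv a b : set (borel S)).
  exact: borel_order_itv.
have htight (x y : S) (e : R) : (0 < e)%R ->
    exists a b : S, (a <= b)%O /\ forall t,
      kernel_pow P t x (~` order_itv a b) <= e%:E /\
      kernel_pow P t y (~` order_itv a b) <= e%:E.
  move=> e0; have [K1 [cK1 hK1]] := hbip x e e0; have [K2 [cK2 hK2]] := hbip y e e0.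
  have [a [b [ab Kab]]] := compact_sub_order_itv hcompact (compactU cK1 cK2).
  have cl (K : set S) : compact K -> closed K by move=> /hcompact[].
  exists a, b; split => // t; split.
  - apply: (setC_order_itv_le hle (cl _ cK1) (hK1 t)) => z Kz.
    by apply: Kab; left.
  - apply: (setC_order_itv_le hle (cl _ cK2) (hK2 t)) => z Kz.
    by apply: Kab; right.
have hr := order_reversing_pair_op mM m1 hrev.
have q0 := not_crossed_cvg0 hinc mM mitv htight hr.
pose mu n : {measure set (borel S) -> \bar R} := kernel_pow P n point.
have muT n : mu n setT = 1 by exact: prob_kernel.
have muC (e : R) : (0 < e)%R ->
    exists N, forall n, (N <= n)%N -> incr_close e (mu n) (mu N).
  by move=> e0; exact: kernel_pow_cauchy.
have muTight (e : R) : (0 < e)%R -> exists a b : S, (a <= b)%O /\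
    forall n, mu n (~` order_itv a b) <= e%:E.
  move=> /(htight point point)[a [b [ab h]]]; exists a, b; split => // n.
  by have [] := h n.
have [phi phiP] := exists_incr_limit hle hcompact hd hS muT muC muTight.
have phiT : phi setT = 1 by exact: probability_setT.
have phicl (e : R) : (0 < e)%R -> exists N, forall n, (N <= n)%N ->
    forall g, incr01 g -> \int[mu n]_x g x <= \int[phi]_x g x + e%:E /\
      \int[phi]_x g x <= \int[mu n]_x g x + e%:E.
  move=> e0; have [N hN] := phiP e e0; exists N => n Nn g ig; split.
    apply: incr_le_integral => //; first exact: ltW.
    by move=> I iI; have [] := hN n Nn I iI.
  apply: incr_le_integral => //; first exact: ltW.
  by move=> I iI; have [] := hN n Nn I iI.
have st : kernel_act phi P ≡μ phi.
  apply: (incr_determines hle hcompact hd hS).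
    by rewrite [X in X < _]probability_setT ltry.
  move=> I iI; have mI : measurable I by case: iI.
  have ih : incr01 (fun x => P x I).
    have -> : (fun x => P x I) = (fun x => \int[kernel_pow P 1 x]_y (\1_I y)%:E).
      apply/funext => x; have [m0 i0 _ _] := incr01_indic R iI.
      rewrite integral_kernel_powS//.
      under eq_integral do rewrite integral_kernel_pow0//.
      by rewrite integral_indic ?setIT.
    by apply: incr01_kernel_pow => //; exact: incr01_indic.
  have muS n : mu n.+1 I = \int[mu n]_x P x I.
    have [m0 i0 _ _] := incr01_indic R iI.
    have -> : mu n.+1 I = \int[kernel_pow P (n + 1) point]_y (\1_I y)%:E.
      by rewrite addn1 integral_indic ?setIT.
    rewrite integral_kernel_powD//; apply: eq_integral => x _.
    rewrite integral_kernel_powS//.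
    under eq_integral do rewrite integral_kernel_pow0//.
    by rewrite integral_indic ?setIT.
  apply/eqP; rewrite eq_le; apply/andP; split; apply/lee_addgt0Pr => e e0;
    have e20 : (0 < e / 2)%R by [rewrite divr_gt0].
  - have [N1 h1] := phicl _ e20; have [N2 h2] := phiP _ e20.
    have [_ c1] := h1 (maxn N1 N2) (leq_maxl _ _) _ ih.
    have [c2 _] := h2 (maxn N1 N2).+1 (leqW (leq_maxr _ _)) I iI.
    apply: (le_trans c1); rewrite -muS [e in leRHS](splitr e) EFinD addeA.
    exact: leeD2r.
  - have [N1 h1] := phicl _ e20; have [N2 h2] := phiP _ e20.
    have [c1 _] := h1 (maxn N1 N2) (leq_maxl _ _) _ ih.
    have [_ c2] := h2 (maxn N1 N2).+1 (leqW (leq_maxr _ _)) I iI.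
    apply: (le_trans c2); rewrite muS [e in leRHS](splitr e) EFinD addeA.
    exact: leeD2r.
exists phi; split.
  by split => // psi; exact: beta_cvg0.
move=> phi' [st' hb'].
have phiT' : phi' setT = 1 by exact: probability_setT.
apply: (incr_determines hle hcompact hd hS).
  by rewrite [X in X < _]probability_setT ltry.
move=> I iI; have mI : measurable I by case: iI.
have close (e : R) : (0 < e)%R -> phi' I <= phi I + e%:E /\ phi I <= phi' I + e%:E.
  move=> e0; have [N _ hN] : \forall t \near \oo,
      (beta (kernel_act phi (kernel_pow P t)) phi' <= e)%R.
    by apply: cvgr_le e0; exact: hb'.
  have actT : kernel_act phi (kernel_pow P N) setT = 1 by exact: probability_setT.
  have [c1 c2] := beta_indic actT phiT' iI.
  have E : kernel_act phi (kernel_pow P N) I = phi I by exact: kernel_act_pow.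
  have bN : (beta (kernel_act phi (kernel_pow P N)) phi')%:E <= e%:E.
    by rewrite lee_fin; exact: (hN N (leqnn N)).
  split.
    by rewrite -E; apply: (le_trans c2); exact: leeD2l.
  by rewrite -E; apply: (le_trans c1); exact: leeD2l.
by apply/eqP; rewrite eq_le; apply/andP; split; apply/lee_addgt0Pr => e /close[].
Qed.

End stability.

Theorem theorem6p1 (R : realType) (d : Order.disp_t)
    (S : POrderedPointedTopological.type d)
    (hS : po_polish R S)
    (hcompact : forall A : set S, compact A <-> closed A /\ order_bounded A)
    (P : R.-pker borel S ~> borel S)
    (hinc : increasing_kernel P)
    (hrev : order_reversing P) :
  globally_stable P <-> bounded_in_probability P.
Proof.
have [sep [dist hd] hord] := hS; have hle := closed_le_rel hd hord.
split; first exact (globally_stable_bounded hle hcompact hd sep (P := P)).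
exact (bounded_globally_stable hle hcompact hd sep hinc hrev).
Qed.
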